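(* For every integer $m\ge 1$, we have $\mathbb{O}(m)^{\circ 2} = \mathbb{SO}(m)^{\circ 2}$, and its degree is $$\deg \mathbb{O}(m)^{\circ 2} = 2^{(m-1)^2}\; \frac{\deg \mathbb{O}(m)}{2^{\binom{m+1}{2}}} \;\le\; 2^{(m-1)^2}.$$
   Context: We work over $\mathbb{C}$. Let $\mathbb{A}^{m^2}$ be the affine space of $m\times m$ complex matrices, viewed as a standard affine chart of $\mathbb{P}^{m^2}$. Let $\mathbb{O}(m)\subset\mathbb{P}^{m^2}$ (resp. $\mathbb{SO}(m)\subset\mathbb{P}^{m^2}$) be the projective closure of the affine variety of orthogonal matrices $\{M \mid M^TM=\mathrm{id}\}\subset\mathbb{A}^{m^2}$ (resp. of special orthogonal matrices $\{M\mid M^TM=\mathrm{id},\ \det M=1\}$). For a projective variety $X\subset\mathbb{P}^N$, $X^{\circ 2}$ denotes its coordinate-wise square, i.e. the image of $X$ under the morphism $\varphi_2\colon\mathbb{P}^N\to\mathbb{P}^N$, $[x_0:\ldots:x_N]\mapsto[x_0^2:\ldots:x_N^2]$. *)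

(* Defs.v *)
From HB Require Import structures.
From mathcomp Require Import all_boot all_order all_algebra.
From mathcomp Require Import generic_quotient.
From mathcomp Require Import boolp classical_sets reals complex.
From mathcomp Require Import mpoly.

Set Implicit Arguments.
Unset Strict Implicit.
Unset Printing Implicit Defensive.

Import Order.TTheory GRing.Theory Num.Theory.
Local Open Scope ring_scope.
Local Open Scope quotient_scope.
Local Open Scope classical_set_scope.

(* Projective N-space over F: nonzero row vectors of length N + 1, modulo
   proportionality. *)

Section ProjectiveSpace.
Variables (F : fieldType) (N : nat).

Definition nzvec : Type := {v : 'rV[F]_N.+1 | v != 0}.
HB.instance Definition _ := Choice.on nzvec.

(* Equality of row spaces; see [prop_vecP]. *)
Definition prop_vec (u v : nzvec) : bool := (val u == val v)%MS.

Lemma prop_vecP (u v : nzvec) :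
  reflect (exists2 c : F, c != 0 & val u = c *: val v) (prop_vec u v).
Proof.
apply: (iffP idP) => [/andP[/sub_rVP[c uv] _]|[c c0 uv]].
  exists c => //; apply: contraNneq (valP u) => c0.
  by rewrite uv c0 scale0r.
rewrite /prop_vec uv; apply/andP; split; first exact: scalemx_sub.
by rewrite -[X in (X <= _)%MS](scalerK c0) scalemx_sub.
Qed.

Lemma prop_vec_refl : reflexive prop_vec.
Proof. by move=> u; rewrite /prop_vec submx_refl. Qed.

Lemma prop_vec_sym : ssrbool.symmetric prop_vec.
Proof. by move=> u v; rewrite /prop_vec andbC. Qed.

Lemma prop_vec_trans : transitive prop_vec.
Proof.
move=> v u w /andP[uv vu] /andP[vw wv].
by rewrite /prop_vec (submx_trans uv vw) (submx_trans wv vu).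
Qed.

Canonical prop_vec_equiv :=
  EquivRel prop_vec prop_vec_refl prop_vec_sym prop_vec_trans.

Definition pspace : Type := {eq_quot prop_vec_equiv}.

Definition hcoord (p : pspace) : 'I_N.+1 -> F := (val (repr p)) 0.

(* For homogeneous [f] this does not depend on the representative chosen by
   [hcoord]; see [form_vanishesE]. *)
Definition form_vanishes (f : {mpoly F[N.+1]}) (p : pspace) : Prop :=
  f.@[hcoord p] = 0.

Definition vanishes_on (f : {mpoly F[N.+1]}) (X : set pspace) : Prop :=
  forall p, X p -> form_vanishes f p.

Definition zariski_closed (Z : set pspace) : Prop :=
  exists S : set {mpoly F[N.+1]},
    (forall f, S f -> exists d, f \is d.-homog) /\
    Z = [set p | forall f, S f -> form_vanishes f p].

Definition zariski_closure (X : set pspace) : set pspace :=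
  smallest zariski_closed X.

Lemma powvec_proof (r : nat) (v : nzvec) :
  map_mx (fun x : F => x ^+ r) (val v) != 0.
Proof.
apply: contraNneq (valP v) => v0; apply/eqP/rowP=> i.
have := congr1 (fun w : 'rV[F]_N.+1 => w 0 i) v0; rewrite !mxE => /eqP.
by rewrite expf_eq0 => /andP[_ /eqP].
Qed.

Definition powvec (r : nat) (v : nzvec) : nzvec :=
  exist (fun w : 'rV[F]_N.+1 => w != 0) _ (powvec_proof r v).

(* [x_0 : ... : x_N] |-> [x_0 ^ r : ... : x_N ^ r]; see [coordpowE]. *)
Definition coordpow (r : nat) (p : pspace) : pspace :=
  \pi_pspace (powvec r (repr p)).

Definition coordwise_power (r : nat) (X : set pspace) : set pspace :=
  coordpow r @` X.

Lemma repr_piP (v : nzvec) :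
  exists2 c : F, c != 0 & val (repr (\pi_pspace v)) = c *: val v.
Proof.
by apply/prop_vecP; have /eqmodP := reprK (\pi_pspace v).
Qed.

Lemma coordpowE (r : nat) (v : nzvec) :
  coordpow r (\pi v) = \pi_pspace (powvec r v).
Proof.
have [c c0 cv] := repr_piP v.
apply/eqmodP/prop_vecP; exists (c ^+ r); first by rewrite expf_neq0.
by apply/rowP=> i; rewrite /= cv !mxE exprMn.
Qed.

Lemma form_vanishesE (d : nat) (f : {mpoly F[N.+1]}) (v : nzvec) :
  f \is d.-homog -> form_vanishes f (\pi v) <-> f.@[(val v) 0] = 0.
Proof.
move=> /dhomogP fd; rewrite /form_vanishes /hcoord.
have [c c0 cv] := repr_piP v.
suff -> : f.@[(val (repr (\pi_pspace v))) 0] = c ^+ d * f.@[(val v) 0].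
  split=> [/eqP|->]; last by rewrite mulr0.
  by rewrite mulf_eq0 expf_eq0 (negPf c0) andbF => /eqP.
rewrite !mevalE mulr_sumr !big_seq; apply: eq_bigr => m /fd /= dm.
rewrite mulrCA -dm; congr (_ * _); rewrite [X in c ^+ X]mdegE -prodrXr -big_split /=.
by apply: eq_bigr => i _; rewrite cv mxE exprMn.
Qed.

End ProjectiveSpace.

Section Degree.
Variables (F : fieldType) (N : nat).
Implicit Type X : set (pspace F N).

(* Degree [t] piece of the homogeneous ideal of [X]; see [ideal_partP]. *)
Definition ideal_part X (t : nat) : {vspace dhomog N.+1 F t} :=
  xget 0%VS [set U : {vspace dhomog N.+1 F t} |
    forall f : dhomog N.+1 F t, f \in U <-> vanishes_on (mpoly_of_dhomog f) X].

Definition hilbert_fun X (t : nat) : nat :=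
  (\dim {: dhomog N.+1 F t} - \dim (ideal_part X t))%N.

Definition is_hilbert_poly X (P : {poly rat}) : Prop :=
  exists t0 : nat, forall t : nat, (t0 <= t)%N ->
    P.[t%:R] = (hilbert_fun X t)%:R.

(* The default 0 is never used: by Hilbert's theorem such a polynomial exists,
   and it is unique by [hilbert_poly_uniq]. *)
Definition hilbert_poly X : {poly rat} := xget 0 [set P | is_hilbert_poly X P].

(* (dim X)! times the leading coefficient of the Hilbert polynomial, whose
   degree is dim X. *)
Definition proj_degree X : rat :=
  ((size (hilbert_poly X)).-1)`!%:R * lead_coef (hilbert_poly X).

Lemma ideal_partP X t (f : dhomog N.+1 F t) :
  f \in ideal_part X t <-> vanishes_on (mpoly_of_dhomog f) X.
Proof.
move: f; rewrite /ideal_part; case: xgetP => [U _ //|noU]; exfalso.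
pose good (U : {vspace dhomog N.+1 F t}) :=
  forall f : dhomog N.+1 F t, f \in U -> vanishes_on (mpoly_of_dhomog f) X.
have grow k : exists2 U, good U & (k <= \dim U)%N.
  elim: k => [|k [U gU dU]].
    exists 0%VS => // f; rewrite memv0 => /eqP-> p _.
    by rewrite /form_vanishes !linear0.
  have [f fX fU] : exists2 f : dhomog N.+1 F t,
      vanishes_on (mpoly_of_dhomog f) X & f \notin U.
    have /existsNP[f nf] := noU U; exists f.
      by apply: contrapT => nX; apply: nf; split=> [/gU|/nX].
    by apply/negP => fU; apply: nf; split=> // _; exact: gU.
  exists (U + <[f]>)%VS.
    move=> g /memv_addP[u uU [w /vlineP[a ->] ->]] p Xp.
    have -> : mpoly_of_dhomog (u + a *: f) =
      mpoly_of_dhomog u + a *: mpoly_of_dhomog f by [].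
    by rewrite /form_vanishes mevalD mevalZ (gU u uU p Xp) (fX p Xp) mulr0 addr0.
  apply: (leq_ltn_trans dU); rewrite ltnNge; apply/negP => le_d.
  have sUW : (U <= U + <[f]>)%VS by exact: addvSl.
  have /eqP eUW : U == (U + <[f]>)%VS by rewrite eqEdim sUW.
  case/negP: fU; rewrite eUW; apply: subvP (addvSr _ _) _ _; exact: memv_line.
have [U _] := grow (\dim {: dhomog N.+1 F t}).+1.
by rewrite ltnNge dimvS // subvf.
Qed.

Lemma hilbert_poly_uniq X P Q :
  is_hilbert_poly X P -> is_hilbert_poly X Q -> P = Q.
Proof.
move=> [t0 hP] [t1 hQ]; apply/eqP; rewrite -subr_eq0; apply/negPn/negP => nz.
pose s : seq rat := [seq t%:R | t <- iota (maxn t0 t1) (size (P - Q))].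
have us : uniq s.
  rewrite map_inj_uniq ?iota_uniq // => a b /eqP.
  by rewrite eqr_nat => /eqP.
have rs : all (root (P - Q)) s.
  apply/allP => _ /mapP[t + ->]; rewrite mem_iota geq_max => /andP[/andP[a b] _].
  by rewrite /root !hornerE hP // hQ // subrr.
by have := max_poly_roots nz rs us; rewrite size_map size_iota ltnn.
Qed.

End Degree.

Section Orthogonal.
Variables (F : fieldType) (m : nat).

Definition chart_vec (M : 'M[F]_m) : 'rV[F]_(m * m).+1 :=
  row_mx (1%:M : 'M[F]_1) (mxvec M).

Lemma chart_vec_neq0 (M : 'M[F]_m) : chart_vec M != 0.
Proof.
have M1 : chart_vec M 0 (lshift (m * m) (0 : 'I_1)) = 1.
  by apply: etrans (row_mxEl _ _ _ _) _; rewrite mxE.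
apply/eqP => M0; move: M1; rewrite M0 mxE => /esym/eqP.
by rewrite oner_eq0.
Qed.

(* M |-> [1 : M], the entries of M being listed by [mxvec]. *)
Definition chart (M : 'M[F]_m) : pspace F (m * m) :=
  \pi_(pspace F (m * m)) 
    (exist (fun w : 'rV[F]_(m * m).+1 => w != 0) _ (chart_vec_neq0 M)).

Definition orthogonal_mx (M : 'M[F]_m) : Prop := M^T *m M = 1%:M.

Definition OO : set (pspace F (m * m)) :=
  zariski_closure (chart @` [set M | orthogonal_mx M]).

Definition SO : set (pspace F (m * m)) :=
  zariski_closure (chart @` [set M | orthogonal_mx M /\ \det M = 1]).

End Orthogonal.

Arguments OO F m : clear implicits.
Arguments SO F m : clear implicits.

(* Main.v *)
(* All degrees are read off Hilbert functions.

   - Bezout inequality: if f is a quadric that is not a zero divisor on Y, then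
     h_Y'(t) + h_Y(t - 2) <= h_Y(t) for every Y' inside Y and {f = 0}.  Imposing
     the equations of orthogonality one at a time goes through irreducible sets,
     since a partial orthonormal frame is moved to the standard one by a fixed
     number of reflections, whose axes can be interpolated by rational curves.
     This gives dim O(m) <= C(m, 2) and deg O(m) <= 2 ^ C(m + 1, 2); the Cayley
     transform gives the lower bound for the dimension.

   - Let e(t) count the forms of degree t in the squares of the coordinates.  The
     group of row and column sign changes has 2 ^ (2m - 1) characters and splits
     the forms of degree 2t on O(m) accordingly.  Each isotypic part is, up to a
     bounded shift of t, of dimension e(t): a monomial fixed by these signs is a
     rational function of the squares.  It suffices to see this for
     x_00 x_0l x_k0 x_kl.  With a_j = x_0j x_kj one has a_0 + ... + a_(m-1) = 0,
     and the product of the forms (+-) a_0 + ... (+-) a_(m-1) with equal signs at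
     0 and l has the shape A(a^2) + a_0 a_l B(a^2); it vanishes on O(m), but not
     after the sign change of a_0, so B does not vanish.  Hence
     h_O(2t) ~ 2 ^ (2m - 1) e(t). *)
Require Import Defs.
From HB Require Import structures.
From mathcomp Require Import all_boot all_order all_algebra.
From mathcomp Require Import boolp classical_sets reals complex.
From mathcomp Require Import mpoly.
From mathcomp Require Import generic_quotient zify ring lra.

Set Implicit Arguments.
Unset Strict Implicit.
Unset Printing Implicit Defensive.

Import Order.TTheory GRing.Theory Num.Theory.
Local Open Scope ring_scope.

(** Generators of the ideal of O(m) never enter: [hilb Y t] is the dimension of the space of
    functions that forms of degree [t] induce on a set [Y] of points. When coordinate 0 is 1 on [Y],
    these are the functions induced by polynomials of degree at most [t]. The obstacle is zero
    divisors, since O(m) has two components. Among the equations of orthogonality only the last one,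
    the norm of the last column, splits the set, so every set that is cut is still irreducible. In
    the comparison with the squares all functions are semi-invariant under sign changes, hence
    determined by their values on matrices of determinant 1. The 2m row and column sign changes
    satisfy one relation, all rows together acting like all columns together; hence 2m - 1. The
    four-entry monomials suffice because, modulo 2, their exponents span the matrices with even row
    and column sums. Passing from t to 2t multiplies a leading coefficient in degree C(m, 2) by 2 ^
    C(m, 2); the rest is C(m, 2) + C(m + 1, 2) = m ^ 2 = (m - 1) ^ 2 + (2m - 1). *)

Section EventuallyPolynomial.

(** * Functions that are eventually polynomial *)

Definition eventually_poly (f : nat -> nat) (P : {poly rat}) : Prop :=
  exists t0 : nat, forall t : nat, (t0 <= t)%N -> P.[t%:R] = (f t)%:R.

Definition antidiff (P Q : {poly rat}) : Prop :=
  forall x, Q.[x + 1] - Q.[x] = P.[x].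

(** The difference of ['X^(n.+1)] is [n.+1] times ['X^n] plus lower powers, whose antidifferences
    are removed by induction. *)
Lemma antidiffXn n : exists Q, antidiff 'X^n Q.
Proof.
elim/ltn_ind: n => n IH.
have [Q hQ] := boolp.choice (fun i : 'I_n => IH i (ltn_ord i)).
exists ((n.+1%:R)^-1 *: ('X^(n.+1) - \sum_(i < n) 'C(n.+1, i)%:R *: Q i)) => x.
have bin : (x + 1) ^+ n.+1 - x ^+ n.+1 =
    n.+1%:R * x ^+ n + \sum_(i < n) 'C(n.+1, i)%:R * x ^+ i.
  rewrite [x + 1]addrC exprDn !big_ord_recr /= binn !expr1n mulr1n !mul1r addrK.
  rewrite binSn addrC -mulr_natl; congr (_ + _); apply: eq_bigr => i _.
  by rewrite expr1n mul1r -mulr_natl.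
have diffQ : (\sum_(i < n) 'C(n.+1, i)%:R *: Q i).[x + 1] -
    (\sum_(i < n) 'C(n.+1, i)%:R *: Q i).[x] = \sum_(i < n) 'C(n.+1, i)%:R * x ^+ i.
  rewrite !horner_sum -sumrB; apply: eq_bigr => i _.
  by rewrite !hornerZ -mulrBr hQ hornerXn.
rewrite !hornerZ -mulrBr !hornerD !hornerN !hornerXn opprD opprK.
move: bin diffQ; set a := (x + 1) ^+ _; set b := x ^+ _.+1; set c := _.[x + 1].
set d := _.[x]; set e := \sum_(i < n) _ => bin diffQ.
have -> : a - c + (- b + d) = n.+1%:R * x ^+ n.
  by move: bin diffQ; set N := _ * _; clearbody a b c d e N => bin diffQ; lra.
by rewrite mulKf ?hornerXn // pnatr_eq0.
Qed.

Lemma antidiffP P : exists Q, antidiff P Q.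
Proof.
have [Q hQ] := boolp.choice antidiffXn.
exists (\sum_(i < size P) P`_i *: Q i) => x.
rewrite !horner_sum -sumrB horner_coef; apply: eq_bigr => i _.
by rewrite !hornerE -mulrBr hQ hornerXn.
Qed.

Lemma eventually_polyD f g P Q : eventually_poly f P -> eventually_poly g Q ->
  eventually_poly (fun t => f t + g t)%N (P + Q).
Proof.
move=> [a ha] [b hb]; exists (maxn a b) => t; rewrite geq_max => /andP[at_ bt].
by rewrite hornerD ha // hb // natrD.
Qed.

Lemma eventually_poly_sum k (f : nat -> nat -> nat) :
  (forall i, (i < k)%N -> exists P, eventually_poly (f i) P) ->
  exists P, eventually_poly (fun t => \sum_(i < k) f i t)%N P.
Proof.
elim: k => [|k IH] hf.
  by exists 0, 0 => t _; rewrite big_ord0 horner0.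
have [|P hP] := IH; first by move=> i ik; apply: hf; rewrite ltnW.
have [Q hQ] := hf k (ltnSn k); exists (P + Q).
have [t0 h] := eventually_polyD hP hQ; exists t0 => t /h ->.
by rewrite big_ord_recr.
Qed.

Lemma eventually_poly_shift k f P : eventually_poly f P ->
  exists Q, eventually_poly (fun t => f (t - k)%N) Q.
Proof.
move=> [t0 h]; exists (P \Po ('X - k%:R%:P)), (t0 + k)%N => t tk.
have kt : (k <= t)%N by apply: leq_trans tk; rewrite leq_addl.
rewrite horner_comp !hornerE -natrB // h //.
by rewrite leq_subRL // addnC.
Qed.

Lemma eventually_poly_psum f P : eventually_poly f P ->
  exists Q, eventually_poly (fun t => \sum_(u < t.+1) f u)%N Q.
Proof.
move=> [t0 h]; have [Q hQ] := antidiffP P.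
exists (Q \Po ('X + 1%:P) + ((\sum_(u < t0) f u)%N%:R - Q.[t0%:R])%:P), t0 => t.
move=> /subnK <-; rewrite addnC; elim: (t - t0)%N => [|s IH].
  rewrite addn0 big_ord_recr /= natrD -h // -hQ !(hornerE, horner_comp).

  by rewrite /= [X in X - _]addrC.
rewrite addnS big_ord_recr /= natrD -IH -h; last by rewrite -addnS leq_addr.
rewrite -hQ !(hornerE, horner_comp) -[(t0 + s).+1]addn1 natrD mulr1n /=.
by set a := Q.[_]; set b := Q.[_]; set c := _%:R; set d := Q.[_]; ring.
Qed.

End EventuallyPolynomial.

(** * Order ideals of monomials *)

Section Downsets.

Definition le_seq (s r : seq nat) : bool := all2 leq s r.

(** Exponent vectors are lists here, so that an induction on the number of variables can split off
    the head. *)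
Definition downset (n : nat) (D : seq nat -> bool) : Prop :=
  forall s r, size r = n -> le_seq s r -> D r -> D s.

Fixpoint compositions (n t : nat) : seq (seq nat) :=
  if n is n'.+1 then
    flatten [seq [seq k :: s | s <- compositions n' (t - k)] | k <- iota 0 t.+1]
  else if t == 0%N then [:: [::]] else [::].

Lemma compositionsS n t : compositions n.+1 t =
  flatten [seq [seq k :: s | s <- compositions n (t - k)] | k <- iota 0 t.+1].
Proof. by []. Qed.

Lemma mem_compositions n t s :
  (s \in compositions n t) = (size s == n) && (sumn s == t).
Proof.
elim: n t s => [|n IH] t s.
  by case: t => [|t]; case: s => //= a s; rewrite ?inE.
rewrite compositionsS; apply/flatten_mapP/andP => [[k]|].
  rewrite mem_iota add0n ltnS => /andP[_ kt] /mapP[r]; rewrite IH.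
  move=> /andP[/eqP sr /eqP rt] ->; rewrite /= sr rt eqxx; split=> //.
  by rewrite subnKC.
case: s => [|k s] [] //=; rewrite eqSS => /eqP ss /eqP st; exists k.
  by rewrite -[0%N :: _]/(iota 0 t.+1) mem_iota /= add0n ltnS -st leq_addr.
by apply: map_f; rewrite IH ss -st addKn !eqxx.
Qed.

Lemma compositions_uniq n t : uniq (compositions n t).
Proof.
elim: n t => [|n IH] t; first by rewrite /=; case: ifP.
rewrite compositionsS; apply: allpairs_uniq_dep; first exact: iota_uniq.
  by move=> k _; apply: IH.
by move=> [k s] [k' s'] _ _ /= [-> ->].
Qed.

Lemma count_compositionsS n t (D : seq nat -> bool) :
  count D (compositions n.+1 t) =
  (\sum_(k < t.+1) count (fun s => D (nat_of_ord k :: s)) (compositions n (t - k)))%N.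
Proof.
rewrite compositionsS count_flatten sumnE !big_map -[iota 0 t.+1]/(index_iota 0 t.+1).
by rewrite big_mkord; apply: eq_bigr => k _; rewrite count_map.
Qed.

Lemma downset_slice n D k : downset n.+1 D -> downset n (fun s => D (k :: s)).
Proof.
move=> hD s r sr le; apply: hD => /=; first by rewrite sr.
by rewrite /le_seq /= leqnn.
Qed.

Lemma le_seq_refl s : le_seq s s.
Proof. by elim: s => //= a s; rewrite /le_seq /= leqnn => ->. Qed.

(* Dickson's lemma, in the form of the descending chain condition. *)
Lemma downset_chain n (D : nat -> seq nat -> bool) :
  (forall k, downset n (D k)) ->
  (forall k s, size s = n -> D k.+1 s -> D k s) ->
  exists K, forall k s, (K <= k)%N -> size s = n -> D k s = D K s.
Proof.
elim: n D => [|n IH] D hD dec.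
  have [[K nK]|all_D] := pselect (exists K, ~~ D K [::]).
    have aux k : (K <= k)%N -> ~~ D k [::].
      move=> /subnK <-; elim: (k - K)%N => // i; rewrite addSn.
      by apply: contra; apply: dec.
    by exists K => k [|//] Kk _; rewrite !(negPf (aux _ _)).
  exists 0%N => k [|//] _ _; apply/idP/idP => _.
    by apply: contrapT => /negP h; apply: all_D; exists 0%N.
  by apply: contrapT => /negP h; apply: all_D; exists k.
have mono k k' s : (k <= k')%N -> size s = n.+1 -> D k' s -> D k s.
  move=> /subnK <- ss; elim: (k' - k)%N => // i IHi; rewrite addSn => h.
  by apply: IHi; apply: dec.
(* The slices of [D k] at head [k] decrease along the diagonal. Once they are stationary at [K], all
   slices with index and head at least [K] coincide, and only the finitely many heads below [K]
   remain. *)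
have decd k s : size s = n -> D k.+1 (k.+1 :: s) -> D k (k :: s).
  move=> ss h; apply: dec; first by rewrite /= ss.
  apply: hD h; first by rewrite /= ss.
  by rewrite /le_seq /= leqnSn; apply: le_seq_refl.
have [K hK] := IH (fun k s => D k (k :: s)) (fun k => downset_slice (hD k)) decd.
have hs j : exists Kj, forall k s, (Kj <= k)%N -> size s = n ->
    D k (j :: s) = D Kj (j :: s).
  apply: (IH (fun k s => D k (j :: s))) => [k|k s ss]; first exact: downset_slice.
  by apply: dec; rewrite /= ss.
have [L hL] := boolp.choice hs.
have Lmax j : (j < K)%N -> (L j <= \max_(i < K) L i)%N.
  by move=> jK; apply: (leq_bigmax (Ordinal jK)).
have diag k j s : (K <= k)%N -> (K <= j)%N -> size s = n ->
    D k (j :: s) = D K (K :: s).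
  move=> Kk Kj ss; apply/idP/idP => h.
    apply: (mono K k) => //; first by rewrite /= ss.
    apply: hD h; rewrite /= ?ss //.
    by rewrite /le_seq /= Kj; apply: le_seq_refl.
  have := hK (maxn k j) s; rewrite leq_max Kk => /(_ isT ss).
  rewrite h => hm; apply: (mono k (maxn k j)); rewrite ?leq_maxl //= ?ss //.
  apply: hD hm; rewrite /= ?ss //.
  by rewrite /le_seq /= leq_maxr; apply: le_seq_refl.
exists (maxn K (\max_(j < K) L j)) => k [//|j s]; rewrite geq_max => /andP[Kk Lk] /= [ss].
have [jK|Kj] := ltnP j K.
  rewrite (hL j k) ?(hL j (maxn _ _)) //; last by apply: leq_trans Lk; apply: Lmax.
  by rewrite leq_max Lmax ?orbT.
by rewrite !diag // leq_maxl.
Qed.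

(** The slices at head [k] decrease with [k] and are constant from some [K] on. The first [K] of
    them contribute shifted counts in one variable fewer, the others a partial sum of a single such
    count. *)
Lemma downset_count n (D : seq nat -> bool) : downset n D ->
  exists P, eventually_poly (fun t => count D (compositions n t)) P.
Proof.
elim: n D => [|n IH] D hD.
  by exists 0, 1%N => -[|t] // _; rewrite horner0.
have dec k s : size s = n -> D (k.+1 :: s) -> D (k :: s).
  move=> ss; apply: hD => /=; first by rewrite ss.
  by rewrite /le_seq /= leqnSn; apply: le_seq_refl.
have [K hK] := downset_chain (fun k => downset_slice (hD : downset n.+1 D)) dec.
have slice k := IH _ (downset_slice (k := k) hD).
have [P1 h1] : exists P, eventually_poly (fun t => \sum_(k < K)
    count (fun s => D (nat_of_ord k :: s)) (compositions n (t - k)))%N P.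
  apply: (eventually_poly_sum (f := fun k t => count (fun s => D (k :: s))
    (compositions n (t - k)))) => k _.
  have [P hP] := slice k; exact: eventually_poly_shift hP.
have [P2 h2] : exists P, eventually_poly (fun t =>
    \sum_(u < (t - K).+1) count (fun s => D (K :: s)) (compositions n u))%N P.
  have [P hP] := slice K; have [Q hQ] := eventually_poly_psum hP.
  exact: eventually_poly_shift hQ.
exists (P1 + P2); have [t0 ht] := eventually_polyD h1 h2.
exists (maxn t0 K) => t; rewrite geq_max => /andP[t0t Kt].
rewrite ht // count_compositionsS; congr (_%:R).
rewrite -!(big_mkord xpredT (fun k => count (fun s => D (k :: s)) (compositions n (t - k)))).
rewrite [RHS](big_cat_nat (n := K)) //=; last exact: leqW.
congr addn; rewrite -[X in (\sum_(X <= i < t.+1) _)%N]add0n big_addn big_mkord subSn //.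
rewrite (reindex_inj rev_ord_inj) /=; apply: eq_bigr => i _.
have le : (i <= t - K)%N by rewrite -ltnS.
rewrite subSS -subnDA addnC.
apply: eq_in_count => s; rewrite mem_compositions => /andP[/eqP ss _].
by rewrite hK // leq_addl.
Qed.

End Downsets.

(** * Independence and spanning of functions on a set *)

Section FunctionFamilies.
Variables (F : fieldType) (T : Type).
Implicit Types (D : set T) (I J : finType).

Definition indep D I (u : I -> T -> F) : Prop :=
  forall c : I -> F, (forall y, D y -> \sum_i c i * u i y = 0) -> forall i, c i = 0.

Definition spanned D I (u : I -> T -> F) (w : T -> F) : Prop :=
  exists c : I -> F, forall y, D y -> w y = \sum_i c i * u i y.

(** If [J] were larger than [I], the matrix of coefficients would have a nonzero left kernel vector,
    which is a relation among the [w j]. *)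
Lemma indep_leq_spanned D I J (u : I -> T -> F) (w : J -> T -> F) :
  indep D w -> (forall j, spanned D u (w j)) -> (#|J| <= #|I|)%N.
Proof.
move=> iw sw; have [C hC] := boolp.choice sw.
rewrite leqNgt; apply/negP => lt.
pose A := \matrix_(j < #|J|, i < #|I|) C (enum_val j) (enum_val i).
have : kermx A != 0.
  rewrite kermx_eq0 /row_free neq_ltn; apply/orP; left.
  exact: leq_ltn_trans (rank_leq_col A) lt.
case/rowV0Pn => d /sub_kermxP dA d0; case/eqP: d0; apply/rowP => j; rewrite mxE.
rewrite -[j]enum_valK; apply: (iw (fun j => d 0 (enum_rank j))) => y Dy.
under eq_bigr => k _ do rewrite (hC k y Dy) mulr_sumr.
rewrite exchange_big /= big1 // => i _.
have := congr1 (fun B : 'rV_ _ => B 0 (enum_rank i)) dA; rewrite !mxE => dA0.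
transitivity ((\sum_j d 0 j * A j (enum_rank i)) * u i y); last first.
  by rewrite dA0 mul0r.
rewrite mulr_suml.
rewrite [RHS](reindex_onto enum_rank enum_val) /=; last by move=> ? _; rewrite enum_valK.
rewrite [RHS](eq_bigl xpredT) => [|k]; last by rewrite enum_rankK eqxx.
by apply: eq_bigr => k _; rewrite mxE !enum_rankK mulrA.
Qed.

Lemma spanned_sum D I (u : I -> T -> F) (K : eqType) (r : seq K) (a : K -> F) (w : K -> T -> F) :
  (forall k, k \in r -> spanned D u (w k)) ->
  spanned D u (fun y => \sum_(k <- r) a k * w k y).
Proof.
elim: r => [|k r IH] h.
  exists (fun=> 0) => y _; rewrite big_nil big1 // => i _; exact: mul0r.
have [|c hc] := IH; first by move=> j jr; apply: h; rewrite inE jr orbT.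
have [d hd] := h k (mem_head k r).
exists (fun i => a k * d i + c i) => y Dy; rewrite big_cons hc // hd //.
rewrite mulr_sumr -big_split /=; apply: eq_bigr => i _; ring.
Qed.

Lemma spanned_eq D I (u : I -> T -> F) (w w' : T -> F) :
  (forall y, D y -> w y = w' y) -> spanned D u w' -> spanned D u w.
Proof. by move=> e [c hc]; exists c => y Dy; rewrite e // hc. Qed.

End FunctionFamilies.

(** * Hilbert functions by standard monomials *)

Section HilbertFunction.
Variables (F : fieldType) (n : nat).
Implicit Type Y : set ('I_n -> F).

(** Only values on [Y] count, so [Y] can be any set of representatives of projective points. *)
Definition form_basis Y (t : nat) (I : finType) (b : I -> {mpoly F[n]}) : Prop :=
  [/\ forall i, b i \is t.-homog,
      indep Y (fun i y => (b i).@[y]) &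
      forall f, f \is t.-homog -> spanned Y (fun i y => (b i).@[y]) (fun y => f.@[y])].

(* The standard monomials, in the sense of Groebner bases, of the homogeneous
   ideal of [Y]. *)
Definition standard Y (m : 'X_{1..n}) : Prop :=
  ~ exists p : {mpoly F[n]},
      (forall m', m' \in msupp p -> mdeg m' = mdeg m /\ (m' < m)%O) /\
      (forall y, Y y -> 'X_[m].@[y] = p.@[y]).

Definition mnm_of_seq (s : seq nat) : 'X_{1..n} := [multinom nth 0%N s i | i < n].

Definition standard_mons Y (t : nat) : seq 'X_{1..n} :=
  [seq mnm_of_seq s | s <- compositions n t & `[< standard Y (mnm_of_seq s) >] ].

Definition hilb Y (t : nat) : nat := size (standard_mons Y t).

Lemma mdeg_mnm_of_seq s : size s = n -> mdeg (mnm_of_seq s) = sumn s.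
Proof.
move=> sn; rewrite mdegE sumnE (big_nth 0%N) sn big_mkord.
by apply: eq_bigr => i _; rewrite mnmE.
Qed.

Lemma mem_standard_mons Y t m :
  (m \in standard_mons Y t) = (mdeg m == t) && `[< standard Y m >].
Proof.
apply/mapP/andP => [[s]|[/eqP mt sm]].
  rewrite mem_filter mem_compositions => /and3P[st /eqP sn /eqP <-] ->.
  by rewrite mdeg_mnm_of_seq.
have e : m = mnm_of_seq m by apply/mnmP => i; rewrite mnmE (mnm_nth 0%N).
exists (tval (multinom_val m)) => //; rewrite mem_filter -e sm mem_compositions size_tuple eqxx.
by rewrite -mt sumnE /mdeg eqxx.
Qed.

Lemma standard_mons_uniq Y t : uniq (standard_mons Y t).
Proof.
rewrite map_inj_in_uniq ?filter_uniq ?compositions_uniq // => s r.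
rewrite !mem_filter !mem_compositions => /and3P[_ /eqP sn _] /and3P[_ /eqP rn _] /mnmP e.
apply: (@eq_from_nth _ 0%N); first by rewrite sn rn.
by move=> i; rewrite sn => lt; have := e (Ordinal lt); rewrite !mnmE.
Qed.

(** Multiplying by ['X_[d]] a rewriting of a monomial by smaller ones gives such a rewriting of its
    multiple. *)
Lemma standard_downset Y :
  downset n (fun s => `[< standard Y (mnm_of_seq s) >]).
Proof.
move=> s r rn le /asboolP sr; apply/asboolP => -[p [lp ep]]; apply: sr.
have le' i : (nth 0 s i <= nth 0 r i)%N.
  elim: s r le i {rn p lp ep} => [|a s IH] [|b r] //= /andP[ab sr] [|i] //=.
  exact: IH.
set d := (mnm_of_seq r - mnm_of_seq s)%MM.
have -> : mnm_of_seq r = (mnm_of_seq s + d)%MM.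
  by apply/mnmP => i; rewrite mnmDE mnmBE !mnmE subnKC.
exists (p * 'X_[d]); split=> [m'|y Yy].
  rewrite (perm_mem (msuppMX _ _)) => /mapP[m /lp[dm ltm] ->].
  by rewrite addmC !mdegD dm ltmc_add2l.
by rewrite mpolyXD !mevalM ep.
Qed.

Theorem hilb_eventually_poly Y : exists P, eventually_poly (hilb Y) P.
Proof.
have [P [t0 hP]] := downset_count (@standard_downset Y).
by exists P, t0 => t /hP ->; rewrite /hilb size_map size_filter.
Qed.

Lemma mpoly_meval_sum (p : {mpoly F[n]}) y :
  p.@[y] = \sum_(m <- msupp p) p@_m * 'X_[m].@[y].
Proof.
by rewrite {1}[p]mpolyE rmorph_sum /=; apply: eq_bigr => m _; rewrite mevalZ.
Qed.

(** In a relation, the largest monomial that occurs would not be standard. Conversely a monomial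
    that is not standard is rewritten by smaller ones, and the monomial order is well-founded. *)
Lemma standard_basis Y t :
  form_basis Y t (fun i : 'I_(hilb Y t) => 'X_[nth 0%MM (standard_mons Y t) i]).
Proof.
set S := standard_mons Y t.
have memS (i : 'I_(hilb Y t)) : nth 0%MM S i \in S by apply: mem_nth.
have degS (i : 'I_(hilb Y t)) : mdeg (nth 0%MM S i) = t.
  by have := memS i; rewrite mem_standard_mons => /andP[/eqP].
split=> [i|c c0 i|f /dhomogP hf].
- by rewrite dhomogX; apply/eqP; exact: degS.
- apply: contrapT => /eqP ci.
  pose M (i : 'I_(hilb Y t)) := nth 0%MM S i.
  case: (Order.TotalTheory.arg_maxP (P := fun k => c k != 0) M ci) => j cj jmax.
  have := memS j; rewrite mem_standard_mons => /andP[_ /asboolP]; apply.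
  exists (\sum_(k | (k != j) && (c k != 0)) (- (c k / c j)) *: 'X_[M k]).
  split=> [m'|y Yy].
    rewrite mcoeff_msupp raddf_sum /= => nz.
    have [k /andP[kj ck] <-] : exists2 k, (k != j) && (c k != 0) & M k = m'.
      apply: contrapT => no; case/eqP: nz; apply: big1 => k hk.
      rewrite mcoeffZ mcoeffX; case: eqP => [e|_]; last by rewrite mulr0.
      by case: no; exists k.
    rewrite !degS; split=> //; rewrite lt_neqAle; apply/andP; split.
      by rewrite nth_uniq ?standard_mons_uniq.
    exact: jmax.
  have := c0 y Yy; rewrite (bigD1 j) //= => /eqP; rewrite addr_eq0 => /eqP e.
  rewrite rmorph_sum /=; apply: (mulfI cj); rewrite e mulr_sumr.
  rewrite [in LHS](bigID (fun k => c k == 0)) /= big1 ?add0r; last first.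
    by move=> k /andP[_ /eqP ->]; rewrite mul0r.
  rewrite -sumrN; apply: eq_bigr => k _; rewrite mevalZ mulrA mulrN mulrCA.
  by rewrite mulfV // mulr1 mulNr.
have spanX m : mdeg m = t -> spanned Y
    (fun i : 'I_(hilb Y t) => meval (R := F) ^~ 'X_[nth 0%MM S i]) (meval (R := F) ^~ 'X_[m]).
  elim/(well_founded_ind (@ltom_wf n)): m => m IH mt.
  have [st|] := pselect (standard Y m).
    have mS : m \in S by rewrite mem_standard_mons mt eqxx; apply/asboolP.
    have iS : (index m S < hilb Y t)%N by rewrite index_mem.
    exists (fun i => (i == Ordinal iS)%:R) => y _.
    rewrite (bigD1 (Ordinal iS)) //= eqxx mul1r nth_index // big1 ?addr0 // => i.
    by move=> /negPf ->; rewrite mul0r.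
  move=> /contrapT[p [lp ep]].
  apply: (spanned_eq (w' := fun y => \sum_(m' <- msupp p) p@_m' * 'X_[m'].@[y])).
    by move=> y Yy; rewrite ep // mpoly_meval_sum.
  apply: spanned_sum => m' m'p; have [dm' ltm'] := lp _ m'p.
  by apply: IH => //; rewrite dm'.
apply: (spanned_eq (w' := fun y => \sum_(m <- msupp f) f@_m * 'X_[m].@[y])).
  by move=> y _; exact: mpoly_meval_sum.
by apply: spanned_sum => m mf; apply/spanX/hf.
Qed.

Lemma form_basis_exists Y t : exists b : 'I_(hilb Y t) -> {mpoly F[n]}, form_basis Y t b.
Proof. by eexists; apply: standard_basis. Qed.

End HilbertFunction.

(** * From sets of points to projective sets *)

Section HilbertFunctionOfVariety.
Variables (F : fieldType) (N : nat).
Implicit Types (X : set (pspace F N)) (Y : set ('I_N.+1 -> F)).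

(** A basis of the forms on [Y] spans a complement of [ideal_part X t]. *)
Lemma hilbert_funE X Y t :
  (forall f : {mpoly F[N.+1]}, f \is t.-homog ->
     vanishes_on f X <-> forall y, Y y -> f.@[y] = 0) ->
  hilbert_fun X t = hilb Y t.
Proof.
move=> XY; have [b [hb ib sb]] := form_basis_exists Y t.
pose B := [tuple DHomog (hb i) | i < hilb Y t].
have BE (i : 'I_(hilb Y t)) : B`_i = DHomog (hb i) by rewrite -tnth_nth tnth_mktuple.
have evalB (c : 'I_(hilb Y t) -> F) y :
    (mpoly_of_dhomog (\sum_i c i *: B`_i)).@[y] = \sum_i c i * (b i).@[y].
  by rewrite linear_sum rmorph_sum /=; apply: eq_bigr => i _; rewrite BE linearZ.
have freeB : free B.
  apply/freeP => c c0; apply: ib => y Yy.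
  by rewrite -evalB c0 !linear0.
have disj : (ideal_part X t :&: <<B>> = 0)%VS.
  apply/eqP; rewrite -subv0; apply/subvP => v; rewrite memv_cap => /andP[vU /coord_span vB].
  rewrite memv0 vB big1 // => i _.
  rewrite (_ : coord B i v = 0) ?scale0r //; move: i.
  apply: ib => y Yy; rewrite -evalB -vB.
  by have /(XY _ (dhomog_is_dhomog v)) := (ideal_partP X v).1 vU; apply.
have full : (ideal_part X t + <<B>> = fullv)%VS.
  apply/eqP; rewrite eqEsubv subvf /=; apply/subvP => f _.
  have [c hc] := sb _ (dhomog_is_dhomog f).
  rewrite -[f](subrK (\sum_i c i *: B`_i)); apply: memv_add.
    apply/ideal_partP/XY; first exact: dhomog_is_dhomog.
    by move=> y Yy; rewrite !linearB /= evalB hc // subrr.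
  apply: memv_suml => i _; apply/memvZ/memv_span.
  by apply: mem_nth; rewrite size_tuple.
rewrite /hilbert_fun -full dimv_disjoint_sum // addKn.
by move: freeB; rewrite /free => /eqP ->; rewrite size_tuple.
Qed.

Lemma proj_degreeE X P : is_hilbert_poly X P ->
  proj_degree X = ((size P).-1)`!%:R * lead_coef P.
Proof.
move=> hP; rewrite /proj_degree /hilbert_poly.
case: xgetP => [Q _ hQ|/(_ P)//]; by rewrite (hilbert_poly_uniq hQ hP).
Qed.

End HilbertFunctionOfVariety.

(** * Degree bounds *)

Section DegreeBounds.
Variable F : fieldType.

(** [msize] is the total degree plus one, and 0 for the zero polynomial, which therefore satisfies
    every bound. *)
Definition deg_le n (f : {mpoly F[n]}) (d : nat) : Prop := (msize f <= d.+1)%N.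

Lemma deg_leM n (f g : {mpoly F[n]}) a b : deg_le f a -> deg_le g b -> deg_le (f * g) (a + b).
Proof.
rewrite /deg_le => fa gb.
have [->|f0] := eqVneq f 0; first by rewrite mul0r mmeasure0.
have [->|g0] := eqVneq g 0; first by rewrite mulr0 mmeasure0.
rewrite msizeM // -ltnS prednK ?addn_gt0 ?lt0n ?msize_poly_eq0 ?f0 //.
by apply: leq_trans (leq_add fa gb) _; rewrite addSn addnS.
Qed.

Lemma deg_le1 n : deg_le (1 : {mpoly F[n]}) 0.
Proof. by rewrite /deg_le msize1. Qed.

Lemma deg_le_prod n (I : Type) (r : seq I) (P : pred I) (f : I -> {mpoly F[n]}) d :
  (forall i, deg_le (f i) (d i)) -> deg_le (\prod_(i <- r | P i) f i) (\sum_(i <- r | P i) d i).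
Proof.
move=> h; apply: (big_ind2 (@deg_le n)) => // [|f1 d1 f2 d2].
  exact: deg_le1.
exact: deg_leM.
Qed.

Lemma deg_leX n (f : {mpoly F[n]}) d k : deg_le f d -> deg_le (f ^+ k) (k * d).
Proof.
move=> h; elim: k => [|k IH]; first by rewrite expr0; apply: deg_le1.
by rewrite exprS mulSn; apply: deg_leM.
Qed.

Lemma deg_le_sum n (I : Type) (r : seq I) (P : pred I) (f : I -> {mpoly F[n]}) d :
  (forall i, P i -> deg_le (f i) d) -> deg_le (\sum_(i <- r | P i) f i) d.
Proof.
move=> h; apply: (big_ind (fun f => deg_le f d)) => // [|f1 f2 h1 h2].
  by rewrite /deg_le mmeasure0.
by apply: leq_trans (msizeD_le _ _) _; rewrite geq_max h1.
Qed.

Lemma deg_leZ n c (f : {mpoly F[n]}) d : deg_le f d -> deg_le (c *: f) d.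
Proof. exact: leq_trans (msizeZ_le _ _). Qed.

Lemma deg_le_comp n k (g : {mpoly F[n]}) (w : n.-tuple {mpoly F[k]}) a d :
  (forall i, deg_le (tnth w i) a) -> deg_le g d -> deg_le (g \mPo w) (d * a).
Proof.
move=> ha hg; rewrite comp_mpolyEX big_seq; apply: deg_le_sum => mn mng.
apply: deg_leZ; rewrite comp_mpolyX.
have : (mdeg mn * a <= d * a)%N.
  by rewrite leq_mul2r -ltnS (leq_trans (msize_mdeg_lt mng) hg) orbT.
rewrite mdegE big_distrl => le; have h : deg_le (\prod_(i < n) tnth w i ^+ mn i) (\sum_(i < n) mn i * a).
  by apply: deg_le_prod => i; apply: deg_leX.
by apply: leq_trans h _; rewrite ltnS; exact: le.
Qed.

End DegreeBounds.

(** * Forms as polynomials on the affine chart *)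

Section AffineChart.
Variables (F : fieldType) (n : nat).
Implicit Type Y : set ('I_n.+1 -> F).

Lemma homogenize d (p : {mpoly F[n.+1]}) : (msize p <= d.+1)%N ->
  exists2 f : {mpoly F[n.+1]}, f \is d.-homog &
    forall y, y ord0 = 1 -> f.@[y] = p.@[y].
Proof.
move=> pd.
exists (\sum_(m <- msupp p) p@_m *: 'X_[m + U_(ord0) *+ (d - mdeg m)]).
  rewrite big_seq; apply: rpred_sum => m mp; apply: rpredZ.
  rewrite dhomogX; apply/eqP; rewrite [LHS]mdegD mdegMn mdeg1 mul1n subnKC //.
  by rewrite -ltnS; apply: leq_trans pd; apply: msize_mdeg_lt.
move=> y y0; rewrite rmorph_sum /= mpoly_meval_sum; apply: eq_bigr => m _.
by rewrite mevalZ mpolyXD -mpolyXn mevalM rmorphXn /= mevalXU y0 expr1n mulr1.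
Qed.

(** By [homogenize] each [p i] has the same values on [Y] as some form of degree [d], so lower
    bounds for [hilb] can be obtained from inhomogeneous polynomials. *)
Lemma hilb_geq Y d (I : finType) (p : I -> {mpoly F[n.+1]}) :
  (forall y, Y y -> y ord0 = 1) -> (forall i, (msize (p i) <= d.+1)%N) ->
  indep Y (fun i y => (p i).@[y]) -> (#|I| <= hilb Y d)%N.
Proof.
move=> Y0 pd ip; have [b [_ _ ss]] := form_basis_exists Y d.
rewrite -[hilb Y d]card_ord; apply: indep_leq_spanned ip _ => i.
have [f hf fE] := homogenize (pd i).
by apply: (spanned_eq (w' := fun y => f.@[y])) (ss _ hf) => y /Y0 /fE.
Qed.

Lemma dhomog_msize_le d (p : {mpoly F[n.+1]}) : p \is d.-homog -> (msize p <= d.+1)%N.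
Proof.
move=> /dhomogP hp; rewrite msizeE; apply/bigmax_leqP_seq => m mp _.
by rewrite (hp m mp : mdeg m = d).
Qed.

(* The inequality behind Bezout's theorem: multiplication by [f] embeds the
   forms on [Y] into those on [Y] that vanish on [Y']. *)
Lemma hilb_hypersurface Y Y' (f : {mpoly F[n.+1]}) k d :
  (forall y, Y y -> y ord0 = 1) -> (Y' `<=` Y)%classic ->
  (msize f <= k.+1)%N -> (forall y, Y' y -> f.@[y] = 0) ->
  (forall g : {mpoly F[n.+1]}, (forall y, Y y -> (f * g).@[y] = 0) ->
     forall y, Y y -> g.@[y] = 0) ->
  (hilb Y' (d + k) + hilb Y d <= hilb Y (d + k))%N.
Proof.
move=> Y0 sub fk f0 reg; have [b [hb ib _]] := form_basis_exists Y' (d + k).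
have [c [hc ic _]] := form_basis_exists Y d.
rewrite -[hilb Y' _]card_ord -[hilb Y d]card_ord -card_sum.
apply: (hilb_geq (p := fun i => match i with inl i => b i | inr j => f * c j end)) => //.
  case=> i; first exact: dhomog_msize_le.
  by rewrite addnC; apply: deg_leM fk _; apply: dhomog_msize_le.
move=> a a0.
have sumE y : \sum_i a i * (match i with inl i => b i | inr j => f * c j end).@[y] =
   \sum_i a (inl i) * (b i).@[y] + (f * \sum_j a (inr j) *: c j).@[y].
  rewrite big_sumType /=; congr (_ + _); rewrite mevalM rmorph_sum /= mulr_sumr.
  by apply: eq_bigr => j _; rewrite mevalM mevalZ mulrCA.
have ab : forall i, a (inl i) = 0.
  apply: ib => y Y'y; have := a0 y (sub _ Y'y).
  by rewrite sumE mevalM f0 // mul0r addr0.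
have ac : forall j, a (inr j) = 0.
  apply: ic => y Yy; have := @reg (\sum_j a (inr j) *: c j).
  rewrite -/c => h; rewrite -[RHS](h _ y Yy).
    by rewrite rmorph_sum; apply: eq_bigr => j _; rewrite /= mevalZ.
  move=> z Yz; have := a0 z Yz; rewrite sumE big1 ?add0r // => i _.
  by rewrite ab mul0r.
by case.
Qed.

End AffineChart.

(** * Growth and leading coefficients *)

Section PolynomialGrowth.
Implicit Types P Q A B : {poly rat}.

Definition eventually (p : nat -> Prop) : Prop :=
  exists t0 : nat, forall t, (t0 <= t)%N -> p t.

Lemma eventuallyI (p q : nat -> Prop) :
  eventually p -> eventually q -> eventually (fun t => p t /\ q t).
Proof.
move=> [a ha] [b hb]; exists (maxn a b) => t; rewrite geq_max => /andP[/ha ? /hb ?].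
by split.
Qed.

(** A bound away from 0, rather than mere positivity, carries the induction: multiplied by [t] it
    outgrows the constant term. *)
Lemma poly_eventually_ge P : 0 < lead_coef P ->
  exists2 e : rat, 0 < e & eventually (fun t => e <= P.[t%:R]).
Proof.
elim/poly_ind: P => [|Q c IH]; first by rewrite lead_coef0 ltxx.
have [->|Q0] := eqVneq Q 0.
  rewrite mul0r add0r lead_coefC => c0; exists c => //; exists 0%N => t _.
  by rewrite hornerC.
have -> : lead_coef (Q * 'X + c%:P) = lead_coef Q.
  rewrite lead_coefDl ?lead_coefMX // size_mulX // ltnS.
  by apply: leq_trans (size_polyC_leq1 _) _; rewrite size_poly_gt0.
move=> /IH[e e0 [t0 h]]; exists e => //.
pose b := Num.bound (`|c| / e); exists (maxn t0 b.+1) => t; rewrite geq_max.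
move=> /andP[/h ht bt]; rewrite !hornerE.
have cb : `|c| <= e * b%:R.
  rewrite mulrC -ler_pdivrMr //; apply: ltW.
  by apply: archi_boundP; rewrite divr_ge0 // ltW.
have tb : e * b.+1%:R <= Q.[t%:R] * t%:R.
  by apply: ler_pM; rewrite ?ler_nat // ltW.
have := ler_normr c; have := lerNnormlW cb.
move: tb; rewrite -[b.+1]addn1 natrD mulrDr mulr1; lra.
Qed.

Lemma poly_eventually_gt0 P : 0 < lead_coef P -> eventually (fun t => 0 < P.[t%:R]).
Proof.
move=> /poly_eventually_ge[e e0 [t0 h]]; exists t0 => t /h.
exact: lt_le_trans.
Qed.

Lemma lead_coef_ge0 P : eventually (fun t => 0 <= P.[t%:R]) -> 0 <= lead_coef P.
Proof.
move=> hP; rewrite leNgt; apply/negP => lt0.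
have lN : 0 < lead_coef (- P) by rewrite lead_coefN oppr_gt0.
have [t0 h] := eventuallyI hP (poly_eventually_gt0 lN).
have [] := h t0 (leqnn _); rewrite hornerN oppr_gt0 => a b.
by have := le_lt_trans a b; rewrite ltxx.
Qed.

Lemma growth_size P Q : eventually (fun t => 0 <= P.[t%:R]) ->
  eventually (fun t => P.[t%:R] <= Q.[t%:R]) -> (size P <= size Q)%N.
Proof.
move=> /lead_coef_ge0 P0 PQ; rewrite leqNgt; apply/negP => lt.
have : 0 <= lead_coef (Q - P).
  by apply: lead_coef_ge0; case: PQ => t0 h; exists t0 => t /h; rewrite hornerD hornerN subr_ge0.
rewrite addrC lead_coefDl ?size_polyN // lead_coefN oppr_ge0 => P0'.
have /eqP : lead_coef P = 0 by apply/le_anti/andP.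
by rewrite lead_coef_eq0 => /eqP P00; rewrite P00 size_poly0 in lt.
Qed.

(** The coefficients at [d] are compared, not the leading ones, because the degrees may be smaller
    than [d]. *)
Lemma growth_coef P Q d : (size P <= d.+1)%N -> (size Q <= d.+1)%N ->
  eventually (fun t => P.[t%:R] <= Q.[t%:R]) -> P`_d <= Q`_d.
Proof.
move=> sP sQ PQ; rewrite -subr_ge0 -coefB.
have : 0 <= lead_coef (Q - P).
  by apply: lead_coef_ge0; case: PQ => t0 h; exists t0 => t /h; rewrite hornerD hornerN subr_ge0.
have sd : (size (Q - P)%R <= d.+1)%N by rewrite (leq_trans (size_polyD _ _)) // size_polyN geq_max sQ.
move: sd; rewrite leq_eqVlt => /predU1P[s|s _]; first by rewrite lead_coefE s.
by rewrite nth_default.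
Qed.

End PolynomialGrowth.

(** * Rational functions of one parameter *)

Section RationalCurves.
Variable F : numFieldType.

Lemma poly_nonroot (p : {poly F}) : p != 0 -> exists s, p.[s] != 0.
Proof.
move=> p0; apply: contrapT => no.
pose s : seq F := [seq t%:R | t <- iota 0 (size p)].
have us : uniq s.
  by rewrite map_inj_uniq ?iota_uniq // => a b /eqP; rewrite eqr_nat => /eqP.
have rs : all (root p) s.
  apply/allP => x _; apply/negP => rx; apply: no; exists x; exact/negP.
by have := max_poly_roots p0 rs us; rewrite size_map size_iota ltnn.
Qed.

(* A rational function of one variable without pole at 0 and 1; its values at
   the poles are arbitrary. *)
Definition regular (u : F -> F) : Prop :=
  exists p q : {poly F}, [/\ q.[0] != 0, q.[1] != 0 &
    forall s, q.[s] != 0 -> u s * q.[s] = p.[s]].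

Lemma regular_poly (p : {poly F}) : regular (fun s => p.[s]).
Proof.
by exists p, 1; rewrite !hornerC oner_neq0; split=> // s _; rewrite hornerC mulr1.
Qed.

Lemma eq_regular (u v : F -> F) : u =1 v -> regular u -> regular v.
Proof. by move=> /funext ->. Qed.

Lemma regular_cst c : regular (fun=> c).
Proof. by apply: eq_regular (regular_poly c%:P) => s; rewrite hornerC. Qed.

Lemma regularD u v : regular u -> regular v -> regular (fun s => u s + v s).
Proof.
move=> [p [q [q0 q1 h]]] [p' [q' [q0' q1' h']]]; exists (p * q' + p' * q), (q * q').
rewrite !hornerM !mulf_neq0 //; split=> // s; rewrite hornerM mulf_eq0 negb_or.
by move=> /andP[qs qs']; rewrite hornerD !hornerM -h // -h' //; ring.
Qed.

Lemma regularM u v : regular u -> regular v -> regular (fun s => u s * v s).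
Proof.
move=> [p [q [q0 q1 h]]] [p' [q' [q0' q1' h']]]; exists (p * p'), (q * q').
rewrite !hornerM !mulf_neq0 //; split=> // s; rewrite hornerM mulf_eq0 negb_or.
by move=> /andP[qs qs']; rewrite !hornerM -h // -h' //; ring.
Qed.

Lemma regularV u : regular u -> u 0 != 0 -> u 1 != 0 -> regular (fun s => (u s)^-1).
Proof.
(* The extra factor [q] excludes the zeros of [q], where nothing is known about [u]. *)
move=> [p [q [q0 q1 h]]] u0 u1; exists (q * q), (p * q).
rewrite !hornerM -!h // !mulf_neq0 //; split=> // s; rewrite hornerM mulf_eq0 negb_or.
move=> /andP[ps qs]; rewrite !hornerM -h // mulrA mulKf //.
by apply: contraNneq ps => us; rewrite -h // us mul0r.
Qed.

Lemma regular_sum (I : Type) (r : seq I) (P : pred I) (u : I -> F -> F) :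
  (forall i, regular (u i)) -> regular (fun s => \sum_(i <- r | P i) u i s).
Proof.
move=> h; elim: r => [|i r IH].
  by apply: eq_regular (regular_cst 0) => s; rewrite big_nil.
case Pi: (P i); last by apply: eq_regular IH => s; rewrite big_cons Pi.
by apply: eq_regular (regularD (h i) IH) => s; rewrite big_cons Pi.
Qed.

Lemma regular_prod (I : Type) (r : seq I) (P : pred I) (u : I -> F -> F) :
  (forall i, regular (u i)) -> regular (fun s => \prod_(i <- r | P i) u i s).
Proof.
move=> h; elim: r => [|i r IH].
  by apply: eq_regular (regular_cst 1) => s; rewrite big_nil.
case Pi: (P i); last by apply: eq_regular IH => s; rewrite big_cons Pi.
by apply: eq_regular (regularM (h i) IH) => s; rewrite big_cons Pi.
Qed.

Lemma regularX u k : regular u -> regular (fun s => u s ^+ k).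
Proof.
move=> h; apply: eq_regular (regular_prod (index_iota 0 k) xpredT (fun=> h)) => s.
by rewrite prodr_const_nat subn0.
Qed.

Lemma regular_meval n (f : {mpoly F[n]}) (v : F -> 'I_n -> F) :
  (forall i, regular (fun s => v s i)) -> regular (fun s => f.@[v s]).
Proof.
move=> h; apply: (eq_regular (u := fun s => \sum_(m <- msupp f) f@_m * \prod_i v s i ^+ m i)).
  by move=> s; rewrite mevalE.
apply: regular_sum => m; apply: regularM; first exact: regular_cst.
by apply: regular_prod => i; apply: regularX.
Qed.

Lemma regular_common_nonzero u v w : regular u -> regular v -> regular w ->
  u 0 != 0 -> v 1 != 0 -> w 0 != 0 -> exists s, [/\ u s != 0, v s != 0 & w s != 0].
Proof.
move=> [a [a' [a0 a1 ha]]] [b [b' [b0 b1 hb]]] [c [c' [c0 c1 hc]]] u0 v1 w0.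
have nz (p : {poly F}) x : p.[x] != 0 -> p != 0.
  by apply: contraNneq => ->; rewrite horner0.
have [|s] := @poly_nonroot ((a * a') * (b * b') * (c * c')).
  rewrite !mulf_neq0 ?(nz _ _ a0) ?(nz _ _ b0) ?(nz _ _ c0) //.
  - by apply: (nz _ 0); rewrite -ha // mulf_neq0.
  - by apply: (nz _ 1); rewrite -hb // mulf_neq0.
  - by apply: (nz _ 0); rewrite -hc // mulf_neq0.
rewrite !hornerM !mulf_eq0 !negb_or => /andP[/andP[/andP[as_ as']] /andP[bs bs'] /andP[cs cs']].
exists s; split.
- by apply: contraNneq as_ => us; rewrite -ha // us mul0r.
- by apply: contraNneq bs => us; rewrite -hb // us mul0r.
- by apply: contraNneq cs => us; rewrite -hc // us mul0r.
Qed.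

Definition regular_mx m n (A : F -> 'M[F]_(m, n)) : Prop :=
  forall i j, regular (fun s => A s i j).

Lemma regular_mx_mul m n k (A : F -> 'M[F]_(m, n)) (B : F -> 'M[F]_(n, k)) :
  regular_mx A -> regular_mx B -> regular_mx (fun s => A s *m B s).
Proof.
move=> hA hB i j; apply: (eq_regular (u := fun s => \sum_k A s i k * B s k j)).
  by move=> s; rewrite mxE.
by apply: regular_sum => l; apply: regularM.
Qed.

Definition segment m n (A B : 'M[F]_(m, n)) (s : F) : 'M[F]_(m, n) :=
  (1 - s) *: A + s *: B.

Lemma segment0 m n (A B : 'M[F]_(m, n)) : segment A B 0 = A.
Proof. by rewrite /segment subr0 scale1r scale0r addr0. Qed.

Lemma segment1 m n (A B : 'M[F]_(m, n)) : segment A B 1 = B.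
Proof. by rewrite /segment subrr scale1r scale0r add0r. Qed.

Lemma regular_segment m n (A B : 'M[F]_(m, n)) : regular_mx (segment A B).
Proof.
move=> i j; apply: eq_regular (regular_poly ((A i j)%:P + (B i j - A i j) *: 'X)) => s.
by rewrite !mxE !hornerE; ring.
Qed.

End RationalCurves.

(** * Substitution of squares and coordinates on the chart *)

Section SquaredVariables.
Variables (F : fieldType) (n : nat).

Definition square_vars : n.-tuple {mpoly F[n]} := [tuple 'X_i ^+ 2 | i < n].

Definition in_squares (g : {mpoly F[n]}) : {mpoly F[n]} := g \mPo square_vars.

End SquaredVariables.

Section ChartCoordinates.
Variables (F : fieldType) (m : nat).

Definition chart_pt (M : 'M[F]_m) : 'I_(m * m).+1 -> F := fun i => chart_vec M 0 i.

Definition entry_index (i j : 'I_m) : 'I_(m * m).+1 := rshift 1 (mxvec_index i j).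

Lemma chart_pt0 M : chart_pt M ord0 = 1.
Proof.
rewrite /chart_pt; have -> : ord0 = lshift (m * m) (0 : 'I_1) by apply: val_inj.
by apply: etrans (row_mxEl _ _ _ _) _; rewrite mxE.
Qed.

Lemma chart_pt_entry M i j : chart_pt M (entry_index i j) = M i j.
Proof. by apply: etrans (row_mxEr _ _ _ _) _; rewrite mxvecE. Qed.

Lemma chart_index_ind (P : 'I_(m * m).+1 -> Prop) :
  P ord0 -> (forall i j, P (entry_index i j)) -> forall k, P k.
Proof.
move=> P0 PE k; have := splitP (k : 'I_(1 + m * m)) => -[j kj|j kj].
  by have -> : k = ord0 by apply: val_inj; rewrite /= kj ord1.
case/mxvec_indexP: j kj => a b kj.
by have -> : k = entry_index a b by apply: val_inj.
Qed.

End ChartCoordinates.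

(** * Sets joined by rational curves *)

Section Linked.
Variables (F : numFieldType) (m : nat).
Implicit Type Y : set 'M[F]_m.

(** A substitute for irreducibility. The function [w] marks the parameters to avoid; being nonzero
    at 0, it is nonzero for almost all parameters. *)
Definition linked Y : Prop := forall A B, Y A -> Y B ->
  exists (g : F -> 'M[F]_m) (w : F -> F),
    [/\ regular_mx g, regular w, g 0 = A, g 1 = B &
        w 0 != 0 /\ forall s, w s != 0 -> Y (g s)].

Lemma regular_chart_pt (g : F -> 'M[F]_m) : regular_mx g ->
  forall i, regular (fun s => chart_pt (g s) i).
Proof.
move=> hg; apply: chart_index_ind => [|i j].
  by apply: eq_regular (regular_cst 1) => s; rewrite chart_pt0.
by apply: eq_regular (hg i j) => s; rewrite chart_pt_entry.
Qed.

(* Restricted to a curve joining a point where [f != 0] to one where [g != 0],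
   the product [f * g] is a product of nonzero rational functions. *)
Lemma linked_prime Y (f g : {mpoly F[(m * m).+1]}) : linked Y ->
  (forall M, Y M -> (f * g).@[chart_pt M] = 0) ->
  (exists2 M, Y M & f.@[chart_pt M] != 0) ->
  forall M, Y M -> g.@[chart_pt M] = 0.
Proof.
move=> lY fg [A YA fA] B YB; apply/eqP; apply/negPn/negP => gB.
have [c [w [hc hw c0 c1 [w0 hY]]]] := lY _ _ YA YB.
have rc := regular_chart_pt hc.
have [|||s [fs gs ws]] := regular_common_nonzero
  (regular_meval f rc) (regular_meval g rc) hw; rewrite ?c0 ?c1 //.
by have /eqP := fg _ (hY _ ws); rewrite mevalM mulf_eq0 (negPf fs) (negPf gs).
Qed.

End Linked.

(** * Reflections and partial orthonormal frames *)

Section Reflections.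
Variables (F : numFieldType) (p : nat).
Local Notation m := p.+1.
Implicit Types (u v w : 'cV[F]_m) (A B M : 'M[F]_m).

Definition dot u v : F := (u^T *m v) 0 0.

Definition refl v : 'M[F]_m := 1%:M - (2 / dot v v) *: (v *m v^T).

Definition basis_vec (i : 'I_m) : 'cV[F]_m := delta_mx i 0.

Lemma dotC u v : dot u v = dot v u.
Proof. by rewrite /dot -[in RHS](trmxK u) -trmx_mul [RHS]mxE. Qed.

Lemma dotDr u v w : dot u (v + w) = dot u v + dot u w.
Proof. by rewrite /dot mulmxDr mxE. Qed.

Lemma dotNr u v : dot u (- v) = - dot u v.
Proof. by rewrite /dot mulmxN mxE. Qed.

Lemma dotDl u v w : dot (v + w) u = dot v u + dot w u.
Proof. by rewrite dotC dotDr ![dot u _]dotC. Qed.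

Lemma dotNl u v : dot (- v) u = - dot v u.
Proof. by rewrite dotC dotNr dotC. Qed.

Lemma dot_basis i v : dot (basis_vec i) v = v i 0.
Proof. by rewrite /dot /basis_vec trmx_delta -rowE mxE. Qed.

Lemma dot_basis_basis i j : dot (basis_vec i) (basis_vec j) = (i == j)%:R.
Proof. by rewrite dot_basis mxE eqxx andbT. Qed.

Lemma gram_dot M a b : (M^T *m M) a b = dot (col a M) (col b M).
Proof. by rewrite /dot !mxE; apply: eq_bigr => j _; rewrite !mxE. Qed.

Lemma mulmx_scalar11 u (c : 'M[F]_1) : u *m c = c 0 0 *: u.
Proof.
by apply/matrixP => i j; rewrite !mxE big_ord1 !ord1 mulrC.
Qed.

Lemma reflE v w : refl v *m w = w - (2 * dot v w / dot v v) *: v.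
Proof.
rewrite /refl mulmxBl mul1mx -scalemxAl -mulmxA mulmx_scalar11 scalerA.
by rewrite mulrAC.
Qed.

Lemma refl_fix v w : dot v w = 0 -> refl v *m w = w.
Proof. by move=> e; rewrite reflE e mulr0 mul0r scale0r subr0. Qed.

Lemma tr_refl v : (refl v)^T = refl v.
Proof. by rewrite /refl linearB /= linearZ /= trmx_mul trmxK trmx1. Qed.

Lemma refl_refl v : dot v v != 0 -> refl v *m refl v = 1%:M.
Proof.
move=> v0; rewrite {2}/refl mulmxBr mulmx1 -scalemxAr mulmxA reflE.
rewrite mulfK // scaler_nat mulr2n opprD addrA subrr add0r mulNmx scalerN opprK.
by rewrite /refl subrK.
Qed.

Lemma refl_swap w e : dot w w = dot e e -> dot (w - e) (w - e) != 0 ->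
  refl (w - e) *m w = e.
Proof.
move=> we n0; rewrite reflE.
have -> : 2 * dot (w - e) w / dot (w - e) (w - e) = 1.
  apply: (mulIf n0); rewrite mulfVK // mul1r.
  by rewrite !(dotDl, dotDr, dotNl, dotNr) we [dot e w]dotC; ring.
by rewrite scale1r opprB addrC subrK.
Qed.

Lemma refl_opp w : dot w w != 0 -> refl w *m (- w) = w.
Proof.
move=> w0; rewrite reflE dotNr mulrN mulNr mulfK // scaleNr opprK scaler_nat.
by rewrite mulr2n addrA addNr add0r.
Qed.

Definition reflections (v : nat -> 'cV[F]_m) (k : nat) : 'M[F]_m :=
  \prod_(i < k.*2) refl (v i).

Lemma reflectionsS (v : nat -> 'cV[F]_m) k : reflections v k.+1 =
  reflections v k *m (refl (v k.*2) *m refl (v k.*2.+1)).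
Proof. by rewrite /reflections doubleS !big_ord_recr /= mulmxA. Qed.

Definition nonisotropic (v : nat -> 'cV[F]_m) (k : nat) : Prop :=
  forall i, (i < k.*2)%N -> dot (v i) (v i) != 0.

Lemma refl_orthogonal v : dot v v != 0 -> orthogonal_mx (refl v).
Proof. by move=> v0; rewrite /orthogonal_mx tr_refl refl_refl. Qed.

Lemma orthogonal_mxM A B : orthogonal_mx A -> orthogonal_mx B -> orthogonal_mx (A *m B).
Proof.
rewrite /orthogonal_mx => hA hB.
by rewrite trmx_mul mulmxA -(mulmxA _ A^T) hA mulmx1.
Qed.

Lemma orthogonal_mx1 : orthogonal_mx (1%:M : 'M[F]_m).
Proof. by rewrite /orthogonal_mx trmx1 mulmx1. Qed.

Lemma reflections_orthogonal (v : nat -> 'cV[F]_m) k : nonisotropic v k -> orthogonal_mx (reflections v k).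
Proof.
move=> hv; rewrite /reflections; apply: big_ind => [||i _].
- exact: orthogonal_mx1.
- exact: orthogonal_mxM.
- exact: refl_orthogonal (hv _ (ltn_ord i)).
Qed.

Lemma eq_reflections (v v' : nat -> 'cV[F]_m) k : (forall i, (i < k.*2)%N -> v i = v' i) ->
  reflections v k = reflections v' k.
Proof. by move=> e; apply: eq_bigr => i _; rewrite e. Qed.

Definition frame M (k : nat) : Prop :=
  forall a b : 'I_m, (a < k)%N -> (b < k)%N -> (M^T *m M) a b = (a == b)%:R.

Definition fixes M (k : nat) : Prop :=
  forall b : 'I_m, (b < k)%N -> col b M = basis_vec b.

Lemma gram_orthogonal_mul A B : orthogonal_mx A -> (A *m B)^T *m (A *m B) = B^T *m B.
Proof. by move=> hA; rewrite trmx_mul mulmxA -(mulmxA _ A^T) hA mulmx1. Qed.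

(* Two reflections send the column [w] to the basis vector [e]; the second
   one only serves to make the number of reflections independent of [w]. *)
Lemma two_reflections w (k : 'I_m) : (k < p)%N -> dot w w = 1 ->
  (forall a : 'I_m, (a < k)%N -> w a 0 = 0) ->
  exists r1 r2, [/\ dot r1 r1 != 0, dot r2 r2 != 0, refl r2 *m (refl r1 *m w) = basis_vec k &
    forall a : 'I_m, (a < k)%N ->
      refl r2 *m (refl r1 *m basis_vec a) = basis_vec a].
Proof.
move=> kp w1 w0; set e := basis_vec k.
have ee : dot e e = 1 by rewrite dot_basis_basis eqxx.
have perp (x : F) (a : 'I_m) : (a < k)%N -> dot (w + x *: e) (basis_vec a) = 0.
  move=> ak; rewrite dotC dot_basis mxE w0 // add0r !mxE.
  by rewrite andbT (_ : (a == k) = false) ?mulr0 //; apply/eqP => ak'; rewrite ak' ltnn in ak.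
have [n0|/negP n0] := eqVneq (dot (w - e) (w - e)) 0; last first.
  (* The padding reflection is in the last basis vector, which is orthogonal to all [basis_vec a]
     with [a <= k] because [k < p]. *)
  exists (w - e), (basis_vec ord_max).
  have fixm (a : 'I_m) : (a <= k)%N -> refl (basis_vec ord_max) *m basis_vec a = basis_vec a.
    move=> ak; apply: refl_fix; rewrite dot_basis_basis.
    rewrite (_ : (_ == _) = false) //; apply/eqP => am.
    by move: ak; rewrite -am /= leqNgt kp.
  split=> [|||a ak]; first exact/negP.
  - by rewrite dot_basis_basis eqxx oner_neq0.
  - by rewrite refl_swap ?fixm ?w1 //; apply/negP.
  - rewrite (refl_fix (w := basis_vec a)) ?fixm //; first by rewrite ltnW.
    by rewrite -scaleN1r perp.
(* If [w - e] is isotropic, possibly zero, then [w + e] has square length 4. Its reflection sends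
   [w] to [- e], and the reflection in [e] sends this to [e]. *)
have we : dot w e = 1.
  move: n0; rewrite !(dotDl, dotDr, dotNl, dotNr) w1 ee [dot e w]dotC => h.
  apply: (mulfI (x := 2)); first by rewrite pnatr_eq0.
  by apply/eqP; rewrite -subr_eq0 -[X in _ == X]oppr0 -h; apply/eqP; ring.
have sw : dot (w - - e) (w - - e) != 0.
  rewrite opprK !(dotDl, dotDr) w1 ee we [dot e w]dotC we.
  have -> : 1 + 1 + (1 + 1) = 4%:R :> F by ring.
  by rewrite pnatr_eq0.
exists (w - - e), e; split=> [//|||a ak]; first by rewrite ee oner_neq0.
  by rewrite refl_swap // ?refl_opp // ?ee ?oner_neq0 // dotNl dotNr opprK ee w1.
rewrite (refl_fix (w := basis_vec a)) ?refl_fix //.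
  by rewrite dot_basis_basis (_ : (k == a) = false) //; apply/eqP => ka; rewrite ka ltnn in ak.
by rewrite opprK -[e]scale1r perp.
Qed.

Lemma col_mulmx A B j : col j (A *m B) = A *m col j B.
Proof. by rewrite !colE mulmxA. Qed.

(** The next column of [B] is orthogonal to the basis vectors already in place, so its first [k]
    entries vanish, and the two reflections that move it fix those vectors. *)
Lemma frame_factor k M : (k <= p)%N -> frame M k ->
  exists (v : nat -> 'cV[F]_m) B, [/\ nonisotropic v k, M = reflections v k *m B & fixes B k].
Proof.
elim: k => [|k IH] kp fM.
  by exists (fun=> 0), M; split=> //; rewrite /reflections big_ord0 mul1mx.
have [|a b ak bk|v [B [nv MB fB]]] := IH; first exact: ltnW.
  by apply: fM; apply: leqW.
have gB : M^T *m M = B^T *m B.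
  by rewrite MB gram_orthogonal_mul //; apply: reflections_orthogonal.
pose K : 'I_m := Ordinal (leqW kp).
have [//|||r1 [r2 [n1 n2 sw fx]]] := @two_reflections (col K B) K.
- by rewrite -gram_dot -gB fM ?eqxx.
- move=> a ak; rewrite -dot_basis -(fB _ ak) -gram_dot -gB fM //.
  + by rewrite (_ : (a == K) = false) //; apply/eqP => e; rewrite e ltnn in ak.
  + exact: ltnW.
pose v' i := if (i < k.*2)%N then v i else if i == k.*2 then r1 else r2.
exists v', (refl r2 *m (refl r1 *m B)); split.
- move=> i; rewrite doubleS /v' => ik; case: ifP => [/nv//|].
  by case: (i == k.*2).
- rewrite reflectionsS (eq_reflections (v' := v)); last first.
    by move=> i ik; rewrite /v' ik.
  rewrite /v' ltnn eqxx ltnNge leqnSn /= eqn_leq ltnn /=.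
  rewrite -!mulmxA (mulmxA (refl r2)) refl_refl // mul1mx (mulmxA (refl r1)) refl_refl //.
  by rewrite mul1mx.
- move=> b bk; rewrite !col_mulmx.
  have [lt|] := ltnP b k; first by rewrite fB // fx.
  rewrite leq_eqVlt ltnNge -ltnS bk orbF => /eqP kb.
  by have -> : b = K by exact: val_inj.
Qed.

Lemma regular_refl (v : F -> 'cV[F]_m) : regular_mx v ->
  dot (v 0) (v 0) != 0 -> dot (v 1) (v 1) != 0 -> regular_mx (fun s => refl (v s)).
Proof.
move=> hv v0 v1 i j.
have htr : regular_mx (fun s => (v s)^T).
  by move=> a b; apply: eq_regular (hv b a) => s; rewrite mxE.
apply: (eq_regular (u := fun s => (i == j)%:R + (-2 * (dot (v s) (v s))^-1) * (v s *m (v s)^T) i j)).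
  by move=> s; rewrite /refl; move: (v s *m _) => X; rewrite !mxE !mulNr.
apply: regularD; first exact: regular_cst.
apply: regularM; last exact: regular_mx_mul.
apply: regularM; first exact: regular_cst.
by apply: regularV => //; apply: regular_mx_mul.
Qed.

Lemma regular_reflections (v : nat -> F -> 'cV[F]_m) k :
  (forall i, regular_mx (v i)) ->
  nonisotropic (fun i => v i 0) k -> nonisotropic (fun i => v i 1) k ->
  regular_mx (fun s => reflections (fun i => v i s) k).
Proof.
move=> hv; rewrite /nonisotropic /reflections; elim: k.*2 => [|n IH] n0 n1.
  by move=> i j; apply: eq_regular (regular_cst _) => s; rewrite big_ord0.
move=> i j; apply: (eq_regular (u := fun s => ((\prod_(i < n) refl (v i s)) *m refl (v n s)) i j)).
  by move=> s; rewrite big_ord_recr.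
apply: regular_mx_mul i j; first by apply: IH => i ik; [apply: n0|apply: n1]; apply: leqW.
by apply: regular_refl; [exact: hv|apply: n0|apply: n1].
Qed.

(** Both ends use the same number of reflections, so axes and normal forms can be interpolated
    linearly. The curve stays in [Y] as long as no interpolated axis is isotropic; [w] is the
    product of the square lengths of the axes. *)
Lemma linked_reflections (Y C : set 'M[F]_m) k :
  (forall A B s, C A -> C B -> C (segment A B s)) ->
  (forall (v : nat -> 'cV[F]_m) B, nonisotropic v k -> C B -> Y (reflections v k *m B)) ->
  (forall M, Y M -> exists (v : nat -> 'cV[F]_m) B, [/\ nonisotropic v k, M = reflections v k *m B & C B]) ->
  linked Y.
Proof.
move=> Cseg CY YC M1 M2 /YC[v1 [B1 [n1 -> C1]]] /YC[v2 [B2 [n2 -> C2]]].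
pose v i s := segment (v1 i) (v2 i) s.
exists (fun s => reflections (fun i => v i s) k *m segment B1 B2 s).
exists (fun s => \prod_(i < k.*2) dot (v i s) (v i s)).
have e0 : (fun i => v i 0) = v1 by apply/funext => i; apply: segment0.
have e1 : (fun i => v i 1) = v2 by apply/funext => i; apply: segment1.
have rv i : regular_mx (v i) by apply: regular_segment.
split.
- apply: regular_mx_mul; last exact: regular_segment.
  by apply: regular_reflections; rewrite ?e0 ?e1.
- apply: regular_prod => i; apply: (regular_mx_mul (A := fun s => (v i s)^T)) => //.
  by move=> a b; apply: eq_regular (rv i b a) => s; rewrite [RHS]mxE.
- by rewrite e0 segment0.
- by rewrite e1 segment1.
split.
  apply/prodf_neq0 => i _.
  by rewrite (congr1 (@^~ (nat_of_ord i)) e0 : v i 0 = v1 i) n1.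
move=> s /prodf_neq0 ns; apply: CY; last exact: Cseg.
by move=> i ik; apply: (ns (Ordinal ik)).
Qed.

End Reflections.

(** * Hilbert polynomials of hypersurface sections *)

Section Bezout.

(** ['X^i - ('X - c%:P) ^+ i] is [c] times [W i], a sum of [i] monic polynomials of degree
    [i.-1]. *)
Lemma shift_diff (P : {poly rat}) (c : rat) D : (size P <= D.+2)%N ->
  (size (P - (P \Po ('X - c%:P)))%R <= D.+1)%N /\
  (P - (P \Po ('X - c%:P)))`_D = c * D.+1%:R * P`_D.+1.
Proof.
move=> sP.
have monQ i j : 'X^i * ('X - c%:P) ^+ j \is monic.
  by rewrite monicMl ?monicXn // monic_exp ?monicXsubC.
have sizeQ i j : size ('X^i * ('X - c%:P) ^+ j) = (i + j).+1.
  rewrite size_monicM ?monicXn ?monic_neq0 ?monic_exp ?monicXsubC //.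
  by rewrite size_polyXn size_exp_XsubC addnS.
pose W i : {poly rat} := \sum_(j < i) 'X^(i.-1 - j) * ('X - c%:P) ^+ j.
have powE i : 'X^i - ('X - c%:P) ^+ i = c *: W i.
  by rewrite subrXX opprB addrC subrK mul_polyC.
have sizeW i : (size (W i) <= i)%N.
  apply: leq_trans (size_sum _ _ _) _; apply/bigmax_leqP => j _.
  by rewrite sizeQ subnK; case: i j => [[]|i j] //; rewrite -ltnS.
have coefW i : (W i.+1)`_i = i.+1%:R.
  rewrite coef_sum (eq_bigr (fun=> 1)) ?sumr_const ?card_ord // => j _.
  have ij : (i - j + j = i)%N by rewrite subnK // -ltnS.
  by have /monicP := monQ (i - j)%N j; rewrite lead_coefE sizeQ ij.
have PE : P = \sum_(i < D.+2) P`_i *: 'X^i.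
  rewrite -poly_def; apply/polyP => i; rewrite coef_poly.
  by case: ltnP => // le; rewrite nth_default // (leq_trans sP).
have -> : P - (P \Po ('X - c%:P)) = \sum_(i < D.+2) (P`_i * c) *: W i.
  have -> : P \Po ('X - c%:P) = \sum_(i < D.+2) P`_i *: ('X - c%:P) ^+ i.
    rewrite {1}PE linear_sum; apply: eq_bigr => i _.
    by rewrite /= comp_polyZ comp_Xn_poly.
  rewrite {1}PE -sumrB; apply: eq_bigr => i _.
  by rewrite -scalerBr powE scalerA.
have sizeS k : (size (\sum_(i < k.+1) (P`_i * c) *: W i)%R <= k)%N.
  apply: leq_trans (size_sum _ _ _) _; apply/bigmax_leqP => i _.
  apply: leq_trans (size_scale_leq _ _) _; apply: leq_trans (sizeW i) _.
  by rewrite -ltnS.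
split; first exact: sizeS.
rewrite big_ord_recr /= coefD coefZ coefW nth_default ?add0r //; first by ring.
exact: sizeS.
Qed.

Variable F : fieldType.

Lemma size_compositions n t : size (compositions n.+1 t) = 'C(t + n, n).
Proof.
elim: n t => [|n IH] t.
  rewrite bin0 -[LHS]/(size _) -(count_predT (compositions 1 t)) count_compositionsS.
  rewrite big_ord_recr /= subnn /= big1 // => i _.
  by case e: (t - i)%N => //; move/eqP: e; rewrite subn_eq0 leqNgt ltn_ord.
rewrite -(count_predT (compositions _ t)) count_compositionsS.
under eq_bigr => k _ do rewrite count_predT IH.
rewrite (reindex_inj rev_ord_inj) /=.
under eq_bigr => k _ do rewrite subSS subKn -1?ltnS //.
elim: t => [|t IHt]; first by rewrite big_ord_recr big_ord0 /= !add0n !binn.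
by rewrite big_ord_recr /= IHt [in RHS]addSn binS addSnnS.
Qed.

Lemma hilb_leq_bin n (Y : set ('I_n.+1 -> F)) t : (hilb Y t <= 'C(t + n, n))%N.
Proof.
by rewrite -size_compositions /hilb size_map size_filter count_size.
Qed.

(** Dimension at most [D] and degree at most [e] in one condition: if the dimension is smaller than
    [D], the coefficient at [D] is 0. *)
Definition hilb_bound n (Y : set ('I_n -> F)) (D : nat) (e : rat) : Prop :=
  exists P, [/\ eventually_poly (hilb Y) P, (size P <= D.+1)%N & D`!%:R * P`_D <= e].

Lemma eventually_poly_ge0 f P : eventually_poly f P -> eventually (fun t => 0 <= P.[t%:R]).
Proof. by move=> [t0 h]; exists t0 => t /h ->. Qed.

Lemma hilb_bound_total n (Y : set ('I_n.+1 -> F)) : hilb_bound Y n 1.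
Proof.
have [P hP] := hilb_eventually_poly Y; exists P.
(* This is the Hilbert polynomial of projective [n]-space, ['C(t + n, n)] as a polynomial in [t]. *)
pose Q : {poly rat} := (n`!%:R)^-1 *: \prod_(i < n) ('X - (- i.+1%:R)%:P).
have f0 : n`!%:R != 0 :> rat by rewrite pnatr_eq0 -lt0n fact_gt0.
have sQ : size Q = n.+1.
  by rewrite size_scale ?invr_neq0 // size_prod_XsubC /index_enum -enumT size_enum_ord.
have QE t : Q.[t%:R] = 'C(t + n, n)%:R.
  apply: (mulfI f0); rewrite hornerZ mulVKf // -natrM mulnC bin_ffact ffact_prod.
  rewrite horner_prod natr_prod [RHS](reindex_inj rev_ord_inj); apply: eq_bigr => i _.
  rewrite !hornerE opprK -natrD; congr (_%:R) => /=.
  by have := ltn_ord i; lia.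
have PQ : eventually (fun t => P.[t%:R] <= Q.[t%:R]).
  by case: hP => t0 h; exists t0 => t /h ->; rewrite QE ler_nat hilb_leq_bin.
have sP : (size P <= n.+1)%N.
  by rewrite -sQ; apply: growth_size PQ; apply: eventually_poly_ge0 hP.
split=> //; have := growth_coef sP _ PQ; rewrite sQ => /(_ (leqnn _)) le.
rewrite mulrC -ler_pdivlMr ?ltr0n ?fact_gt0 //; apply: le_trans le _.
have : lead_coef Q = (n`!%:R)^-1.
  by rewrite lead_coefZ (monicP (monic_prod_XsubC _ _ _)) mulr1.
by rewrite lead_coefE sQ /= => ->; rewrite mul1r.
Qed.

(** The Hilbert polynomial of [Y'] is at most [P(t) - P(t - 2)], whose coefficient at [D] is
    [2 * D.+1] times that of [P] at [D.+1]; the factor [D.+1] is absorbed by the factorial. *)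
Lemma hilb_bound_hypersurface n (Y Y' : set ('I_n -> F)) D e :
  (forall d, (hilb Y' (d + 2) + hilb Y d <= hilb Y (d + 2))%N) ->
  hilb_bound Y D.+1 e -> hilb_bound Y' D (2 * e).
Proof.
move=> le [P [hP sP eP]]; have [P' hP'] := hilb_eventually_poly Y'; exists P'.
have [sQ cQ] := shift_diff 2 sP; set Q := P - _ in sQ cQ.
have PQ : eventually (fun t => P'.[t%:R] <= Q.[t%:R]).
  have [t0 h] := hP; have [t1 h'] := hP'.
  exists (maxn t0 t1 + 2)%N => t tt.
  have [d td] : exists d, t = (d + 2)%N by exists (t - 2)%N; lia.
  rewrite td in tt *; rewrite !(hornerE, horner_comp) h' ?h; [|lia|lia].
  rewrite natrD addrK h; last by lia.
  by rewrite lerBrDr -natrD ler_nat.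
have sP' : (size P' <= D.+1)%N.
  by apply: leq_trans sQ; apply: growth_size PQ; apply: eventually_poly_ge0 hP'.
split=> //; have le' := growth_coef sP' sQ PQ.
apply: le_trans (ler_wpM2l (ler0n _ _) le') _; rewrite cQ.
have -> : D`!%:R * (2 * D.+1%:R * P`_D.+1) = 2 * (D.+1`!%:R * P`_D.+1).
  by rewrite factS natrM; ring.
by rewrite ler_pM2l.
Qed.

End Bezout.

(** * The equations of orthogonality, one at a time *)

Section GramSets.
Variables (F : numFieldType) (p : nat).
Local Notation m := p.+1.

Definition pts (Y : set 'M[F]_m) : set ('I_(m * m).+1 -> F) := (@chart_pt F m @` Y)%classic.

Lemma pts_chart0 Y y : pts Y y -> y ord0 = 1.
Proof. by move=> [M _ <-]; exact: chart_pt0. Qed.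

Lemma linked_hypersurface (Y Y' : set 'M[F]_m) (f : {mpoly F[(m * m).+1]}) D e :
  linked Y -> (Y' `<=` Y)%classic -> (msize f <= 3)%N ->
  (forall M, Y' M -> f.@[chart_pt M] = 0) ->
  (exists2 M, Y M & f.@[chart_pt M] != 0) ->
  hilb_bound (pts Y) D.+1 e -> hilb_bound (pts Y') D (2 * e).
Proof.
move=> lY sub sf f0 fn0; apply: hilb_bound_hypersurface => d.
apply: (hilb_hypersurface (f := f)) => //.
- exact: pts_chart0.
- by move=> _ [M YM <-]; exists M => //; apply: sub.
- by move=> _ [M YM <-]; apply: f0.
- move=> g fg _ [M YM <-]; apply: linked_prime lY _ fn0 _ YM => N YN.
  by apply: fg; exists N.
Qed.

Definition gram_mpoly (a b : 'I_m) : {mpoly F[(m * m).+1]} :=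
  \sum_i 'X_(entry_index i a) * 'X_(entry_index i b) - ((a == b)%:R)%:MP.

Lemma gram_mpolyE a b M : (gram_mpoly a b).@[chart_pt M] = (M^T *m M) a b - (a == b)%:R.
Proof.
rewrite /gram_mpoly mevalB mevalC rmorph_sum /= mxE; congr (_ - _).
by apply: eq_bigr => i _; rewrite mevalM !mevalXU !chart_pt_entry mxE.
Qed.

Lemma msize_gram_mpoly a b : (msize (gram_mpoly a b) <= 3)%N.
Proof.
apply: leq_trans (msizeD_le _ _) _; rewrite geq_max msizeN; apply/andP; split.
  apply: leq_trans (msize_sum _ _ _) _; apply/bigmax_leqP => i _.
  by rewrite -mpolyXD msizeX mdegD !mdeg1.
by rewrite msizeC; case: (_ != _).
Qed.

(* [MᵀM] agrees with the identity in the positions [(a, b)], [a <= b], up to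
   and excluding [(j, k)] in the lexicographic order of [(b, a)]. *)
Definition gram_set (k j : nat) : set 'M[F]_m := [set M | forall a b : 'I_m, (a <= b)%N ->
  ((b < k)%N \/ (b = k :> nat) /\ (a < j)%N) -> (M^T *m M) a b = (a == b)%:R]%classic.

(** For [j <= k], this is what the conditions become once the first [k] columns are basis vectors.
    They are affine-linear, hence stable under [segment]. *)
Definition gram_normal (k j : nat) : set 'M[F]_m := [set B | fixes B k /\
  forall a b : 'I_m, b = k :> nat -> (a < j)%N -> B a b = 0]%classic.

Lemma gram_sym (M : 'M[F]_m) a b : (M^T *m M) a b = (M^T *m M) b a.
Proof. by rewrite !gram_dot dotC. Qed.

Lemma gram_set_frame k j M : gram_set k j M -> frame M k.
Proof.
move=> h a b ak bk; have [ab|/ltnW ba] := leqP a b; first by apply: h => //; left.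
by rewrite gram_sym eq_sym; apply: h => //; left.
Qed.

Lemma fixes_gram k (B : 'M[F]_m) (a b : 'I_m) : fixes B k -> (a < k)%N ->
  (B^T *m B) a b = B a b.
Proof. by move=> fB ak; rewrite gram_dot fB // dot_basis mxE. Qed.

Lemma gram_normal_set k j B : (j <= k)%N -> gram_normal k j B -> gram_set k j B.
Proof.
move=> jk [fB zB] a b ab [bk|[bk aj]].
  rewrite (fixes_gram _ fB) ?(leq_ltn_trans ab) //.
  have := fB b bk => /(congr1 (fun v : 'cV_m => v a 0)); rewrite !mxE => ->.
  by rewrite eqxx andbT.
rewrite (fixes_gram _ fB) ?(leq_trans aj) // zB //.
rewrite (_ : (a == b) = false) //; apply/eqP => e.
by rewrite e bk ltnNge jk in aj.
Qed.

Lemma gram_set_normal k j B : (j <= k)%N -> fixes B k -> gram_set k j B -> gram_normal k j B.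
Proof.
move=> jk fB h; split=> // a b bk aj; have ak := leq_trans aj jk.
rewrite -(fixes_gram b fB) // h.
- rewrite (_ : (a == b) = false) //; apply/eqP => e.
  by rewrite e bk ltnn in ak.
- by rewrite bk ltnW.
- by right.
Qed.

Lemma gram_set_mul k j A B : orthogonal_mx A -> gram_set k j (A *m B) <-> gram_set k j B.
Proof. by move=> oA; rewrite /gram_set /= gram_orthogonal_mul. Qed.

(** The bound [j <= k] keeps out the norm of column [k], the one condition on this column that stays
    quadratic in normal form. *)
Lemma gram_set_linked k j : (k <= p)%N -> (j <= k)%N -> linked (gram_set k j).
Proof.
move=> kp jk; apply: (@linked_reflections _ _ _ (gram_normal k j) k).
- move=> A B s [fA zA] [fB zB]; split=> [b bk|a b bk aj].
    by rewrite /segment linearD !linearZ /= fA // fB // -scalerDl subrK scale1r.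
  by rewrite /segment !mxE zA // zB // !mulr0 addr0.
- move=> v B nv /(gram_normal_set jk) hB.
  by apply/gram_set_mul => //; apply: reflections_orthogonal.
move=> M hM; have [v [B [nv MB fB]]] := frame_factor kp (gram_set_frame hM).
exists v, B; split=> //; apply: gram_set_normal => //.
by apply/(gram_set_mul k j B (reflections_orthogonal nv)); rewrite -MB.
Qed.

Lemma gram_set_step k j D e : (k <= p)%N -> (j <= k)%N ->
  hilb_bound (pts (gram_set k j)) D.+1 e -> hilb_bound (pts (gram_set k j.+1)) D (2 * e).
Proof.
move=> kp jk.
pose K : 'I_m := Ordinal (kp : (k < m)%N); pose J : 'I_m := Ordinal (leq_ltn_trans jk (kp : (k < m)%N)).
apply: (linked_hypersurface (f := gram_mpoly J K)).
- exact: gram_set_linked.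
- move=> M h a b ab [bk|[bk aj]]; apply: h => //; first by left.
  by right; split=> //; apply: leqW.
- exact: msize_gram_mpoly.
- by move=> M h; rewrite gram_mpolyE h ?subrr //; right.
(* A matrix that satisfies the earlier equations but not the one at [(J, K)]: column [K] is
   [basis_vec J] if [j < k], and 0 if [j = k]. *)
pose B : 'M[F]_m := \matrix_(i, b) if b == K then ((j < k)%N && (i == J))%:R else (i == b)%:R.
have fB : fixes B k.
  move=> b bk; apply/colP => i; rewrite !mxE eqxx andbT.
  by rewrite (_ : (b == K) = false) //; apply/eqP => e'; rewrite e' ltnn in bk.
exists B.
  apply: gram_normal_set => //; split=> // a b bk aj; rewrite mxE.
  have -> : (b == K) by apply/eqP/val_inj.
  by rewrite (_ : (a == J) = false) ?andbF //; apply/eqP => e'; rewrite e' ltnn in aj.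
rewrite gram_mpolyE; have [lt|ge] := ltnP j k.
  rewrite (fixes_gram _ fB) // mxE eqxx lt eqxx /=.
  rewrite (_ : (J == K) = false) ?subr0 ?oner_neq0 //.
  by apply/eqP => /(congr1 val) /= e'; rewrite e' ltnn in lt.
have -> : J = K by apply: val_inj; apply/eqP; rewrite eqn_leq jk.
rewrite mxE big1 ?eqxx ?sub0r ?oppr_eq0 ?oner_neq0 // => i _.
by rewrite !mxE eqxx ltnNge ge mulr0.
Qed.

Lemma bin2S k : 'C(k.+2, 2) = ('C(k.+1, 2) + k.+1)%N.
Proof. by rewrite binS bin1. Qed.

Lemma bin2_sum_square k : ('C(k, 2) + 'C(k.+1, 2) = k * k)%N.
Proof. by elim: k => // k IH; rewrite bin2S [in LHS]addnA; case: k IH => [//|k]; rewrite !bin2S; lia. Qed.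

(** At this stage ['C(k.+1, 2) + j] equations are imposed, each of which costs one dimension and a
    factor 2. *)
Lemma gram_set_bound k j D : (k <= p)%N -> (j <= k.+1)%N -> (D + 'C(k.+1, 2) + j = m * m)%N ->
  hilb_bound (pts (gram_set k j)) D (2 ^+ ('C(k.+1, 2) + j)).
Proof.
elim: k j D => [|k IHk] j D kp; elim: j D => [|j IHj] D jk e.
- rewrite addn0 in e.
  have -> : D = (m * m)%N by rewrite -e /= addn0.
  exact: hilb_bound_total.
- rewrite addnS exprS; apply: gram_set_step => //; apply: IHj; first exact: ltnW.
  by rewrite -e !addSn addnS.
(* Once its norm is imposed, column [k] belongs to the frame, and two more reflections straighten
   it. *)
- have -> : gram_set k.+1 0 = gram_set k k.+1.
    apply/seteqP; split=> M h a b ab.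
      case=> [bk|[bk ak]]; apply: h => //; left; first exact: leqW.
      by rewrite bk.
    rewrite ltnS leq_eqVlt; case=> [/orP[/eqP bk|bk]|[_]//]; apply: h => //; last by left.
    by right; split=> //; rewrite ltnS -bk.
  rewrite addn0 bin2S; apply: IHk => //; first exact: ltnW.
  by rewrite -e bin2S addn0 addnA.
- rewrite addnS exprS; apply: gram_set_step => //; apply: IHj; first exact: ltnW.
  by rewrite -e !addSn addnS.
Qed.

Lemma orthogonal_bound :
  hilb_bound (pts [set M | orthogonal_mx M]%classic) 'C(m, 2) (2 ^+ 'C(m.+1, 2)).
Proof.
have -> : [set M | orthogonal_mx M]%classic = gram_set p m.
  apply/seteqP; split=> M /= h.
    by move=> a b _ _; rewrite h mxE.
  apply/matrixP => a b; rewrite [RHS]mxE.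
  have E (i j : 'I_m) : (i <= j)%N -> (M^T *m M) i j = (i == j)%:R.
    move=> ij; apply: h => //; have := ltn_ord j; rewrite ltnS leq_eqVlt.
    by case/orP => [/eqP jp|]; [right|left].
  have [ab|/ltnW ba] := leqP a b; first exact: E.
  by rewrite gram_sym E // eq_sym.
rewrite bin2S; apply: gram_set_bound => //.
by rewrite -addnA -bin2S bin2_sum_square.
Qed.

End GramSets.

(** * The Cayley transform and the dimension from below *)

Section Cayley.
Variables (F : numFieldType) (p : nat).
Local Notation m := p.+1.

Lemma digits_inj K d (e e' : nat -> nat) :
  (forall i, (i < d)%N -> (e i < K)%N) -> (forall i, (i < d)%N -> (e' i < K)%N) ->
  (\sum_(i < d) e i * K ^ i = \sum_(i < d) e' i * K ^ i)%N ->
  forall i, (i < d)%N -> e i = e' i.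
Proof.
elim: d e e' => // d IH e e' he he'.
have split_sum (f : nat -> nat) :
    (\sum_(i < d.+1) f i * K ^ i = (\sum_(i < d) f i.+1 * K ^ i) * K + f 0)%N.
  rewrite big_ord_recl expn0 muln1 addnC big_distrl; congr (_ + _)%N.
  by apply: eq_bigr => i _; rewrite lift0 expnS mulnCA mulnC.
rewrite !split_sum => h; have K0 : (0 < K)%N by apply: leq_trans (he 0%N _).
have e0 : e 0%N = e' 0%N.
  by have := congr1 (modn^~ K) h; rewrite !modnMDl !modn_small ?he ?he'.
move: h; rewrite e0 => /addIn/eqP; rewrite eqn_pmul2r // => /eqP h [|i] // id.
by apply: (IH (fun i => e i.+1) (fun i => e' i.+1)) => // j jd; [apply: he|apply: he'].
Qed.

Definition generic_mx : 'M[{mpoly F[(m * m).+1]}]_m := \matrix_(i, j) 'X_(entry_index i j).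

Lemma generic_mxE M : map_mx (meval (chart_pt M)) generic_mx = M.
Proof. by apply/matrixP => i j; rewrite !mxE mevalXU chart_pt_entry. Qed.

Definition cayley_den : {mpoly F[(m * m).+1]} := \det (1%:M + generic_mx).

(** Numerators, over [cayley_den], of the entries of the inverse Cayley transform of the generic
    matrix. *)
Definition cayley_num (i j : 'I_m) : {mpoly F[(m * m).+1]} :=
  ((1%:M - generic_mx) *m \adj (1%:M + generic_mx)) i j.

Lemma cayley_denE M : cayley_den.@[chart_pt M] = \det (1%:M + M).
Proof. by rewrite -det_map_mx map_mxD map_mx1 generic_mxE. Qed.

Lemma cayley_numE i j M :
  (cayley_num i j).@[chart_pt M] = ((1%:M - M) *m \adj (1%:M + M)) i j.
Proof.
transitivity (map_mx (meval (chart_pt M))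
  ((1%:M - generic_mx) *m \adj (1%:M + generic_mx)) i j); first by rewrite [RHS]mxE.
by rewrite map_mxM map_mxB map_mx_adj map_mxD map_mx1 generic_mxE.
Qed.

(* With [M = (1 - A) (1 + A)^-1] one has [1 + M = 2 (1 + A)^-1] and
   [1 - M = A (1 + M)]. *)
Lemma cayley (A : 'M[F]_m) : A^T = - A -> \det (1%:M + A) != 0 ->
  exists M, [/\ orthogonal_mx M, \det (1%:M + M) != 0 &
    (1%:M - M) *m \adj (1%:M + M) = \det (1%:M + M) *: A].
Proof.
move=> skA dA; set B := 1%:M + A.
have uB : B \in unitmx by rewrite unitmxE unitfE.
have trB : B^T = 1%:M - A by rewrite linearD /= trmx1 skA.
have BB : B *m (1%:M - A) = (1%:M - A) *m B.
  by rewrite /B !mulmxDl !mulmxDr !mul1mx !mulmx1 mulmxN mulNmx addrACA.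
pose M := (1%:M - A) *m invmx B.
have M1 : 1%:M + M = 2 *: invmx B.
  rewrite -[X in X + _](mulmxV uB) -mulmxDl /B addrACA subrr addr0.
  by rewrite mulmxDl mul1mx scaler_nat mulr2n.
have M2 : 1%:M - M = A *m (1%:M + M).
  rewrite M1 -[X in X - _](mulmxV uB) -mulmxBl /B opprB addrC addrA subrK.
  by rewrite mulmxDl -scalemxAr scaler_nat mulr2n.
exists M; split.
- rewrite /orthogonal_mx /M trmx_mul -trB trmxK trmx_inv.
  rewrite -mulmxA (mulmxA B) trB BB -trB -mulmxA mulmxV // mulmx1.
  by rewrite mulVmx // unitmx_tr.
- by rewrite M1 detZ mulf_neq0 ?expf_neq0 ?pnatr_eq0 // -unitfE -unitmxE unitmx_inv.
- by rewrite M2 -mulmxA mul_mx_adj mul_mx_scalar.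
Qed.

Definition upper_index : predArgType := {ij : 'I_m * 'I_m | (ij.1 < ij.2)%N}.
HB.instance Definition _ := Finite.on upper_index.

Lemma card_upper_index : #|{: upper_index}| = 'C(m, 2).
Proof.
rewrite card_sig -sum1_card; rewrite -(pair_big_dep xpredT (fun i j : 'I_m => (i < j)%N) (fun _ _ => 1%N)) /=.
rewrite (exchange_big_dep xpredT) //=.
rewrite -bin2_sum; rewrite big_mkord; apply: eq_bigr => j _.
by rewrite -(big_ord_widen m (fun=> 1%N) (ltnW (ltn_ord j))) sum1_card card_ord.
Qed.

(** The entries of [A] above the diagonal are ['C(m, 2)] free coordinates, so their monomials with
    exponents at most [k] are independent. Powers of [cayley_den] clear the denominators at a cost
    in degree that is linear in [k]. *)
Theorem orthogonal_lower : exists2 c, (0 < c)%N & forall k,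
  (k.+1 ^ 'C(m, 2) <= hilb (pts [set M : 'M[F]_m | orthogonal_mx M]%classic) (c * k))%N.
Proof.
pose num (i : upper_index) := cayley_num (val i).1 (val i).2.
pose c0 := (msize cayley_den + \max_i msize (num i))%N.
have dd : deg_le cayley_den c0 by rewrite /deg_le leqW // leq_addr.
have dn i : deg_le (num i) c0.
  by rewrite /deg_le leqW // (leq_trans _ (leq_addl _ _)) // (leq_bigmax i).
(* The successor makes the constant positive even when [m] is 1 and there is no coordinate. *)
exists ('C(m, 2) * c0).+1 => // k.
pose P (e : {ffun upper_index -> 'I_k.+1}) :=
  \prod_i (num i ^+ e i * cayley_den ^+ (k - e i)).
have -> : (k.+1 ^ 'C(m, 2) = #|{ffun upper_index -> 'I_k.+1}|)%N.
  by rewrite card_ffun card_ord card_upper_index.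
apply: (hilb_geq (p := P)); first exact: pts_chart0.
  move=> e; have := @deg_le_prod _ _ _ (index_enum upper_index) xpredT
    (fun i => num i ^+ e i * cayley_den ^+ (k - e i)) (fun=> k * c0)%N.
  rewrite sum_nat_const card_upper_index [(k * c0)%N]mulnC mulnA => h.
  have le : ('C(m, 2) * c0 * k <= ('C(m, 2) * c0).+1 * k)%N by rewrite leq_mul2r leqnSn orbT.
  apply: leq_trans (h _) _; last by rewrite ltnS.
  move=> i.
  have -> : (c0 * k = e i * c0 + (k - e i) * c0)%N.
    by rewrite -mulnDl subnKC 1?mulnC // -ltnS.
  by apply: deg_leM; apply: deg_leX.
move=> c c0E.
(* Kronecker substitution: the coordinates become powers of one variable with exponents [k.+1 ^ r],
   so that distinct [e] give distinct exponents [N e], read in base [k.+1]. *)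
pose code (i : upper_index) := (k.+1 ^ enum_rank i)%N.
pose N (e : {ffun upper_index -> 'I_k.+1}) := (\sum_i e i * code i)%N.
have N_inj : injective N.
  move=> e e' /eqP; rewrite /N.
  have NE (f : {ffun upper_index -> 'I_k.+1}) : (\sum_i f i * code i =
      \sum_(r < #|{: upper_index}|) f (enum_val r) * k.+1 ^ r)%N.
    rewrite (reindex_onto enum_val enum_rank) /=; last by move=> ? _; rewrite enum_rankK.
    rewrite (eq_bigl xpredT) => [|r]; last by rewrite enum_valK eqxx.
    by apply: eq_bigr => r _; rewrite /code enum_valK.
  pose dig (f : {ffun upper_index -> 'I_k.+1}) r :=
    if insub r is Some r' then nat_of_ord (f (enum_val (r' : 'I_#|{: upper_index}|))) else 0%N.
  have digE (f : {ffun upper_index -> 'I_k.+1}) (r : 'I_#|{: upper_index}|) :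
    dig f r = f (enum_val r) by rewrite /dig valK.
  rewrite !NE => /eqP h.
  have := @digits_inj k.+1 #|{: upper_index}| (dig e) (dig e').
  have lt f r : (dig f r < k.+1)%N by rewrite /dig; case: insubP.
  under [in X in _ -> _ -> X -> _]eq_bigr => r _ do rewrite digE.
  under [in X in _ -> _ -> _ = X -> _]eq_bigr => r _ do rewrite digE.
  move=> /(_ (fun r _ => lt e r) (fun r _ => lt e' r) h) eq.
  apply/ffunP => i; apply: val_inj.
  by have := eq _ (ltn_ord (enum_rank i)); rewrite !digE enum_rankK.
pose a (i j : 'I_m) : {poly F} :=
  if insub (i, j) is Some u then 'X^(code u) else 0.
pose AX : 'M[{poly F}]_m := \matrix_(i, j) (a i j - a j i).
pose A s := map_mx (horner_eval s) AX.
pose D := \det (1%:M + AX).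
have DE s : D.[s] = \det (1%:M + A s).
  by rewrite -[LHS]/(horner_eval s D) -det_map_mx map_mxD map_mx1.
have AE s (u : upper_index) : A s (val u).1 (val u).2 = s ^+ code u.
  rewrite !mxE /a -surjective_pairing valK insubN; last first.
    by rewrite /= -leqNgt ltnW //; apply: (valP u).
  by rewrite subr0 /horner_eval hornerXn.
have skA s : (A s)^T = - A s.
  by apply/matrixP => i j; rewrite !mxE /horner_eval -hornerN opprB.
have D0 : D != 0.
  suff : D.[0] != 0 by apply: contraNneq => ->; rewrite horner0.
  rewrite DE (_ : A 0 = 0) ?addr0 ?det1 ?oner_neq0 //.
  have a0 i j : (a i j).[0] = 0.
    rewrite /a; case: insubP => [u _ _|_]; last by rewrite horner0.
    by rewrite hornerXn expr0n expn_eq0.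
  by apply/matrixP => i j; rewrite !mxE /horner_eval hornerD hornerN !a0 subrr.
pose S : {poly F} := \sum_e c e *: 'X^(N e).
(* Where [D] does not vanish, [A s] has a Cayley transform [M], at which the relation reads [S.[s] =
   0] up to a power of [d]. *)
have SD : S * D = 0.
  apply/eqP/negPn/negP => /poly_nonroot[s]; rewrite hornerM mulf_eq0 negb_or.
  case/andP => Ss; rewrite DE => Ds; case/negP: Ss.
  have [M [oM dM numM]] := cayley (skA s) Ds.
  set d := \det (1%:M + M) in dM numM.
  have PE e : (P e).@[chart_pt M] = d ^+ (k * 'C(m, 2)) * s ^+ N e.
    rewrite rmorph_prod /=.
    under eq_bigr => i _ do rewrite mevalM !rmorphXn /= cayley_numE cayley_denE numM mxE AE
      -/d exprMn mulrAC -exprD subnKC -1?ltnS // -exprM mulnC.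
    rewrite big_split /= prodr_const card_upper_index -exprM /N prodrXr.
    by [].
  have := c0E (chart_pt M); under eq_bigr => e _ do rewrite PE mulrCA.
  rewrite -mulr_sumr => /(_ _)/eqP; rewrite mulf_eq0 expf_eq0 (negPf dM) andbF /=.
  rewrite /S horner_sum; under [in X in _ -> X]eq_bigr => e _ do rewrite hornerZ hornerXn.
  by apply; exists M.
move/eqP: SD; rewrite mulf_eq0 (negPf D0) orbF => /eqP S0 e.
have := congr1 (fun q : {poly F} => q`_(N e)) S0.
rewrite coef0 coef_sum (bigD1 e) //= coefZ coefXn eqxx mulr1 big1 ?addr0 //.
move=> e' ne; rewrite coefZ coefXn (_ : (N e == N e') = false) ?mulr0 //.
by apply/eqP => /N_inj ee'; rewrite ee' eqxx in ne.
Qed.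

End Cayley.

(** * Sign changes and semi-invariant functions *)

Section Signs.
Variables (F : numFieldType) (p : nat).
Local Notation m := p.+1.
Implicit Types (M : 'M[F]_m) (E : 'I_m -> 'I_m -> nat).

Definition sign_index : finType := ('I_m + 'I_p)%type.

(* [sign_index] lists generators of the group of row and column sign changes:
   all columns, and all rows but the first. *)
Definition flipped (x : sign_index) (i j : 'I_m) : bool :=
  match x with inl c => j == c | inr r => i == lift ord0 r end.

Definition flip (x : sign_index) M : 'M[F]_m := \matrix_(i, j) ((-1) ^+ flipped x i j * M i j).

Definition OM : set 'M[F]_m := [set M | orthogonal_mx M]%classic.

Lemma flip_orthogonal x M : OM M -> OM (flip x M).
Proof.
rewrite /OM /= /orthogonal_mx => oM; apply/matrixP => a b; rewrite [RHS]mxE.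
have gE a' b' : \sum_i M i a' * M i b' = (a' == b')%:R.
  have := congr1 (fun A : 'M_m => A a' b') oM; rewrite !mxE => <-.
  by apply: eq_bigr => i _; rewrite mxE.
have -> : ((flip x M)^T *m flip x M) a b =
    \sum_i ((-1) ^+ flipped x i a * (-1) ^+ flipped x i b) * (M i a * M i b).
  by rewrite mxE; apply: eq_bigr => i _; rewrite !mxE; ring.
case: x => [c|r] /=.
  rewrite -mulr_sumr gE; have [->|_] := eqVneq a b; last by rewrite mulr0.
  by rewrite -expr2 sqrr_sign mulr1.
by rewrite -gE; apply: eq_bigr => i _; rewrite -expr2 sqrr_sign mul1r.
Qed.

Definition mxmon E M : F := \prod_i \prod_j M i j ^+ E i j.

Definition parity (x : sign_index) E : nat := \sum_i \sum_j flipped x i j * E i j.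

Lemma mxmon_flip x E M : mxmon E (flip x M) = (-1) ^+ parity x E * mxmon E M.
Proof.
rewrite /mxmon /parity -prodrXr -big_split /=; apply: eq_bigr => i _.
rewrite -prodrXr -big_split /=; apply: eq_bigr => j _.
by rewrite mxE exprMn exprM.
Qed.

Lemma mxmonD E E' M : mxmon (fun i j => E i j + E' i j)%N M = mxmon E M * mxmon E' M.
Proof.
rewrite /mxmon -big_split /=; apply: eq_bigr => i _.
by rewrite -big_split /=; apply: eq_bigr => j _; rewrite exprD.
Qed.

Lemma parityD x E E' : parity x (fun i j => E i j + E' i j)%N = (parity x E + parity x E')%N.
Proof.
rewrite /parity -big_split /=; apply: eq_bigr => i _.
by rewrite -big_split /=; apply: eq_bigr => j _; rewrite mulnDr.
Qed.

Definition mxmon_mpoly E : {mpoly F[(m * m).+1]} := \prod_i \prod_j 'X_(entry_index i j) ^+ E i j.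

Lemma mxmon_mpolyE E M : (mxmon_mpoly E).@[chart_pt M] = mxmon E M.
Proof.
rewrite rmorph_prod /=; apply: eq_bigr => i _; rewrite rmorph_prod /=.
by apply: eq_bigr => j _; rewrite rmorphXn /= mevalXU chart_pt_entry.
Qed.

Lemma deg_mxmon_mpoly E : deg_le (mxmon_mpoly E) (\sum_i \sum_j E i j).
Proof.
apply: deg_le_prod => i; apply: deg_le_prod => j.
by have := @deg_leX _ _ ('X_(entry_index i j)) 1 (E i j); rewrite muln1; apply; rewrite /deg_le msizeX mdeg1.
Qed.

Lemma big_chart (R : Type) (idx : R) (op : Monoid.com_law idx) (f : 'I_(m * m).+1 -> R) :
  \big[op/idx]_k f k = op (f ord0) (\big[op/idx]_i \big[op/idx]_j f (entry_index i j)).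
Proof.
rewrite big_ord_recl; congr (op _ _); rewrite pair_big /=.
rewrite (reindex _ (curry_mxvec_bij m m)) /=; apply: eq_bigr => -[i j] _ /=.
by congr f; apply: val_inj.
Qed.

Definition mx_exponents (A : 'X_{1..(m * m).+1}) i j : nat := A (entry_index i j).

Lemma meval_monomial A M : 'X_[A].@[chart_pt M] = mxmon (mx_exponents A) M.
Proof.
rewrite mevalX big_chart /= chart_pt0 expr1n mul1r.
by apply: eq_bigr => i _; apply: eq_bigr => j _; rewrite chart_pt_entry.
Qed.

Lemma mx_exponents_leq A : (\sum_i \sum_j mx_exponents A i j <= mdeg A)%N.
Proof. by rewrite mdegE big_chart leq_addl. Qed.

(** A character of the sign group is encoded by the set of generators on which it takes the value
    -1. *)
Definition character E : {set sign_index} := [set x | odd (parity x E)].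

Lemma sign_parity x E : (-1) ^+ parity x E = (-1) ^+ (x \in character E) :> F.
Proof. by rewrite inE -signr_odd. Qed.

Definition semi_invariant (chi : {set sign_index}) (u : 'M[F]_m -> F) : Prop :=
  forall x M, OM M -> u (flip x M) = (-1) ^+ (x \in chi) * u M.

Lemma semi_mxmon E : semi_invariant (character E) (mxmon E).
Proof. by move=> x M _; rewrite mxmon_flip sign_parity. Qed.

(** Adding to the relation its translate by a generator [x], with the sign of [chi] at [x], kills
    the terms whose character differs from [chi] at [x]. After all generators only [chi] is left. *)
Lemma semi_invariant_separate (u : {set sign_index} -> 'M[F]_m -> F) :
  (forall chi, semi_invariant chi (u chi)) ->
  (forall M, OM M -> \sum_chi u chi M = 0) ->
  forall chi M, OM M -> u chi M = 0.
Proof.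
move=> su u0 chi M oM.
have main (l : seq sign_index) : forall M, OM M ->
    \sum_(psi : {set sign_index} | all (fun x => (x \in psi) == (x \in chi)) l) u psi M = 0.
  elim: l => [|x l IH] N oN /=; first exact: u0.
  have h1 := IH _ oN; have h2 := IH _ (flip_orthogonal x oN).
  apply: (mulfI (x := 2)); first by rewrite pnatr_eq0.
  rewrite mulr0; transitivity (\sum_(psi : {set sign_index} |
      all (fun x => (x \in psi) == (x \in chi)) l) u psi N + (-1) ^+ (x \in chi) *
    \sum_(psi : {set sign_index} |
      all (fun x => (x \in psi) == (x \in chi)) l) u psi (flip x N)); last first.
    by rewrite h1 h2 mulr0 addr0.
  rewrite !mulr_sumr big_mkcond [in RHS]big_mkcond [X in _ = _ + X]big_mkcond -big_split /=.
  apply: eq_bigr => psi _; case: (all _ l); rewrite ?andbT ?andbF ?addr0 //.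
  rewrite su // mulrA -signr_addb.
  by case: (x \in chi); case: (x \in psi) => /=; rewrite ?expr0 ?expr1; ring.
have := main (index_enum sign_index) M oM; rewrite (big_pred1 chi) // => psi.
apply/allP/eqP => [h|-> //]; apply/setP => x; apply/eqP/h; exact: mem_index_enum.
Qed.

(** Products of an even number of reflections, hence of determinant 1. Unlike [OM] this set is
    linked, and it covers [OM] up to a sign change of one column. *)
Definition SM : set 'M[F]_m :=
  [set M | exists2 v : nat -> 'cV[F]_m, nonisotropic v p & M = reflections v p]%classic.

Lemma SM_linked : linked SM.
Proof.
apply: (@linked_reflections _ _ _ [set 1%:M]%classic p).
- by move=> A B s -> ->; rewrite /segment -scalerDl subrK scale1r.
- by move=> v B nv ->; exists v => //; rewrite mulmx1.
- by move=> M [v nv ->]; exists v, 1%:M; split=> //; rewrite mulmx1.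
Qed.

Lemma SM_OM M : SM M -> OM M.
Proof. by move=> [v nv ->]; apply: reflections_orthogonal. Qed.

(** [frame_factor] straightens all columns but the last, for which orthogonality leaves only the
    last basis vector and its opposite. *)
Lemma OM_SM M : OM M -> SM M \/ SM (flip (inl ord_max) M).
Proof.
move=> oM; have fM : frame M p by move=> a b _ _; rewrite oM mxE.
have [v [B [nv MB fB]]] := frame_factor (leqnn p) fM.
have oB : B^T *m B = 1%:M.
  by rewrite -oM MB gram_orthogonal_mul //; apply: reflections_orthogonal.
have colB (a b : 'I_m) : (b < p)%N -> B a b = (a == b)%:R.
  by move=> /fB /(congr1 (fun v : 'cV_m => v a 0)); rewrite !mxE eqxx andbT.
have lastE (b : 'I_m) : (b < p)%N = false -> b = ord_max.
  move=> bp; apply: val_inj; apply/eqP; rewrite /= eqn_leq -ltnS ltn_ord /=.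
  by rewrite leqNgt bp.
have colmax (a : 'I_m) : (a < p)%N -> B a ord_max = 0.
  move=> ap; rewrite -(fixes_gram ord_max fB ap) oB mxE (_ : (a == ord_max) = false) //.
  by apply/eqP => e; rewrite e ltnn in ap.
have b2 : B ord_max ord_max ^+ 2 = 1.
  have := congr1 (fun A : 'M_m => A ord_max ord_max) oB; rewrite mxE (bigD1 ord_max) //=.
  rewrite big1 ?addr0 => [|i ne]; first by rewrite !mxE eqxx expr2.
  rewrite mxE colmax ?mul0r //; apply: contraNT ne => /negPf /lastE ->; exact: eqxx.
have BE a b : B a b = if (b < p)%N then (a == b)%:R else if a == b then B ord_max ord_max else 0.
  case: ifP => [/colB//|/lastE ->]; case: eqP => [->//|/eqP ne].
  by apply: colmax; apply: contraNT ne => /negPf /lastE ->.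
move/eqP: b2; rewrite sqrf_eq1 => /orP[]/eqP b1; [left|right]; exists v => //.
  rewrite MB (_ : B = 1%:M) ?mulmx1 //; apply/matrixP => a b; rewrite mxE BE b1.
  by case: ifP => // _; case: eqP.
have -> : flip (inl ord_max) M = reflections v p *m flip (inl ord_max) B.
  apply/matrixP => a b; rewrite !mxE MB mxE mulr_sumr; apply: eq_bigr => i _.
  by rewrite !mxE /= mulrCA.
rewrite (_ : flip _ B = 1%:M) ?mulmx1 //; apply/matrixP => a b; rewrite !mxE BE b1 /=.
case: ifP => [bp|/lastE ->].
  rewrite (_ : (b == ord_max) = false) ?mul1r //.
  by apply/eqP => e; rewrite e ltnn in bp.
by rewrite eqxx; case: eqP => _; rewrite ?mulr0 // expr1 mulrNN mulr1.
Qed.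

Lemma semi_invariant_zero chi u : semi_invariant chi u ->
  (forall M, SM M -> u M = 0) -> forall M, OM M -> u M = 0.
Proof.
move=> su u0 M oM; have [/u0//|/u0] := OM_SM oM.
by rewrite su // => /eqP; rewrite mulf_eq0 signr_eq0 => /eqP.
Qed.

(** On the reducible set [OM] a product of nonzero functions can vanish. A semi-invariant function
    that vanishes on [SM] vanishes on all of [OM], so the claim can be tested on the linked set
    [SM]. *)
Lemma semi_invariant_prime chi psi (f g : {mpoly F[(m * m).+1]}) :
  semi_invariant chi (fun M => f.@[chart_pt M]) ->
  semi_invariant psi (fun M => g.@[chart_pt M]) ->
  (exists2 M, OM M & f.@[chart_pt M] != 0) ->
  (forall M, OM M -> f.@[chart_pt M] * g.@[chart_pt M] = 0) ->
  forall M, OM M -> g.@[chart_pt M] = 0.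
Proof.
move=> sf sg [A oA fA] fg; apply: semi_invariant_zero sg _.
apply: (linked_prime (f := f) SM_linked) => [M /SM_OM /fg|].
  by rewrite mevalM.
apply: contrapT => no; case/eqP: fA; apply: (semi_invariant_zero sf) oA => M sM.
by apply: contrapT => /eqP fM; apply: no; exists M.
Qed.

Lemma semi_invariantM chi psi u w : semi_invariant chi u -> semi_invariant psi w ->
  exists phi, semi_invariant phi (fun M => u M * w M).
Proof.
move=> su sw; exists [set x | (x \in chi) (+) (x \in psi)] => x M oM.
by rewrite su // sw // inE signr_addb; ring.
Qed.

Lemma semi_invariant_nonzeroM chi psi (f g : {mpoly F[(m * m).+1]}) :
  semi_invariant chi (fun M => f.@[chart_pt M]) ->
  semi_invariant psi (fun M => g.@[chart_pt M]) ->
  (exists2 M, OM M & f.@[chart_pt M] != 0) ->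
  (exists2 M, OM M & g.@[chart_pt M] != 0) ->
  exists2 M, OM M & f.@[chart_pt M] * g.@[chart_pt M] != 0.
Proof.
move=> sf sg f0 [B oB gB]; apply: contrapT => no; case/eqP: gB.
apply: (semi_invariant_prime sf sg f0) oB => M oM.
by apply: contrapT => /eqP h; apply: no; exists M.
Qed.

Lemma eq_semi_invariant chi (u w : 'M[F]_m -> F) :
  u =1 w -> semi_invariant chi u -> semi_invariant chi w.
Proof. by move=> /funext ->. Qed.

Lemma refl_entry (v : 'cV[F]_m) i j :
  refl v i j = (i == j)%:R - 2 / dot v v * (v i 0 * v j 0).
Proof.
have vv : (v *m v^T) i j = v i 0 * v j 0 by rewrite mxE big_ord1 mxE.
by rewrite -vv /refl; move: (v *m v^T) => X; rewrite !mxE.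
Qed.

(* The witness is the reflection in [(m + 1, 1, ..., 1)]. *)
Lemma orthogonal_no_zero_entry : exists2 M, OM M & forall i j, M i j != 0.
Proof.
pose a (i : 'I_m) : nat := if i == ord0 then m.+1 else 1%N.
pose v : 'cV[F]_m := \col_i (a i)%:R.
have vE : dot v v = (m.+1 * m.+1 + p)%N%:R.
  rewrite /dot mxE big_ord_recl !mxE /a eqxx natrD natrM; congr (_ + _).
  rewrite -[in RHS](card_ord p) -sumr_const; apply: eq_bigr => i _.
  by rewrite !mxE /= mulr1.
have v0 : dot v v != 0 by rewrite vE pnatr_eq0.
exists (refl v); first exact: refl_orthogonal.
move=> i j; rewrite refl_entry !mxE; apply/eqP => /(congr1 (fun x => dot v v * x)).
rewrite mulr0 mulrBr mulrA [dot v v * (2 / _)]mulrC mulfVK // vE -!natrM => /eqP.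
rewrite subr_eq0 eqr_nat /a => /eqP.
by case: (eqVneq i j) => [->|_]; repeat case: ifP => _; nia.
Qed.

Lemma mxmon_nonzero E : exists2 M, OM M & mxmon E M != 0.
Proof.
have [M oM nz] := orthogonal_no_zero_entry; exists M => //.
by apply/prodf_neq0 => i _; apply/prodf_neq0 => j _; rewrite expf_neq0.
Qed.

End Signs.

(** * Rational functions of the squared entries *)

Section Squares.
Variables (F : numFieldType) (p : nat).
Local Notation m := p.+1.
Local Notation OM := (@OM F p).
Implicit Types (M : 'M[F]_m) (E : 'I_m -> 'I_m -> nat).

Definition square_pt M : 'I_(m * m).+1 -> F := fun i => chart_pt M i ^+ 2.

Lemma in_squaresE (g : {mpoly F[(m * m).+1]}) M : (in_squares g).@[chart_pt M] = g.@[square_pt M].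
Proof.
rewrite /in_squares comp_mpoly_meval; apply: meval_eq => i.
by rewrite tnth_mktuple rmorphXn /= mevalXU.
Qed.

Lemma deg_in_squares n (g : {mpoly F[n]}) d : deg_le g d -> deg_le (in_squares g) (d * 2).
Proof.
apply: deg_le_comp => i; rewrite tnth_mktuple.
by apply: (@deg_leX _ _ _ 1 2); rewrite /deg_le msizeX mdeg1.
Qed.

Lemma square_pt_flip x M : square_pt (flip x M) =1 square_pt M.
Proof.
apply: chart_index_ind => [|i j]; rewrite /square_pt ?chart_pt0 // !chart_pt_entry mxE.
by rewrite exprMn sqrr_sign mul1r.
Qed.

Lemma semi_in_squares (g : {mpoly F[(m * m).+1]}) :
  semi_invariant finset.set0 (fun M => (in_squares g).@[chart_pt M]).
Proof.
move=> x M _; rewrite !in_squaresE inE expr0 mul1r.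
exact: meval_eq (square_pt_flip x M).
Qed.

Lemma in_squares_mxmon E M : (mxmon_mpoly F E).@[square_pt M] = mxmon E M ^+ 2.
Proof.
rewrite rmorph_prod /= /mxmon -prodrXl; apply: eq_bigr => i _; rewrite rmorph_prod /= -prodrXl.
apply: eq_bigr => j _; rewrite rmorphXn /= mevalXU /square_pt chart_pt_entry.
by rewrite -!exprM mulnC.
Qed.

Definition nonzero_on_squares (q : {mpoly F[(m * m).+1]}) : Prop :=
  exists2 M, OM M & q.@[square_pt M] != 0.

Lemma nonzero_on_squaresM q q' : nonzero_on_squares q -> nonzero_on_squares q' ->
  nonzero_on_squares (q * q').
Proof.
move=> [A oA qA] [B oB qB].
have [||M oM] := semi_invariant_nonzeroM (semi_in_squares q) (semi_in_squares q').
- by exists A => //; rewrite in_squaresE.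
- by exists B => //; rewrite in_squaresE.
by rewrite !in_squaresE -mevalM; exists M.
Qed.

Lemma nonzero_on_squares_mxmon E : nonzero_on_squares (mxmon_mpoly F E).
Proof.
have [M oM nz] := mxmon_nonzero F E; exists M => //.
by rewrite in_squares_mxmon expf_neq0.
Qed.

(* [u] is, on the orthogonal matrices, a rational function of the squares of
   the entries. *)
Definition square_rational (u : 'M[F]_m -> F) : Prop :=
  exists q g : {mpoly F[(m * m).+1]}, nonzero_on_squares q /\
    forall M, OM M -> q.@[square_pt M] * u M = g.@[square_pt M].

Lemma square_rational_mpoly (g : {mpoly F[(m * m).+1]}) :
  square_rational (fun M => g.@[square_pt M]).
Proof.
exists 1, g; split=> [|M _]; last by rewrite meval1 mul1r.
by exists 1%:M; [apply: orthogonal_mx1|rewrite meval1 oner_neq0].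
Qed.

Lemma square_rationalM u w : square_rational u -> square_rational w ->
  square_rational (fun M => u M * w M).
Proof.
move=> [q [g [q0 h]]] [q' [g' [q0' h']]]; exists (q * q'), (g * g').
split=> [|M oM]; first exact: nonzero_on_squaresM.
by rewrite !mevalM -h // -h' //; ring.
Qed.

Lemma eq_square_rational u w : (forall M, OM M -> u M = w M) ->
  square_rational u -> square_rational w.
Proof. by move=> e [q [g [q0 h]]]; exists q, g; split=> // M oM; rewrite -e // h. Qed.

Lemma square_rational_prod (I : Type) (r : seq I) (P : pred I) (u : I -> 'M[F]_m -> F) :
  (forall i, square_rational (u i)) -> square_rational (fun M => \prod_(i <- r | P i) u i M).
Proof.
move=> h; elim: r => [|i r IH].
  by apply: eq_square_rational (square_rational_mpoly 1) => M _; rewrite big_nil meval1.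
case Pi: (P i); last by apply: eq_square_rational IH => M _; rewrite big_cons Pi.
by apply: eq_square_rational (square_rationalM (h i) IH) => M _; rewrite big_cons Pi.
Qed.

Lemma square_rationalX u k : square_rational u -> square_rational (fun M => u M ^+ k).
Proof.
move=> h; apply: eq_square_rational (square_rational_prod (index_iota 0 k) xpredT (fun=> h)) => M _.
by rewrite prodr_const_nat subn0.
Qed.

Lemma square_rational_div (y : {mpoly F[(m * m).+1]}) u w : nonzero_on_squares y ->
  (forall M, OM M -> y.@[square_pt M] * u M = w M) -> square_rational w -> square_rational u.
Proof.
move=> y0 e [q [g [q0 h]]]; exists (q * y), g; split=> [|M oM]; first exact: nonzero_on_squaresM.
by rewrite mevalM -mulrA e // h.
Qed.

Lemma square_rational_common (I : finType) (u : I -> 'M[F]_m -> F) :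
  (forall i, square_rational (u i)) ->
  exists q (g : I -> {mpoly F[(m * m).+1]}), nonzero_on_squares q /\
    forall i M, OM M -> q.@[square_pt M] * u i M = (g i).@[square_pt M].
Proof.
move=> h; have [q hq] := boolp.choice h; have [g hg] := boolp.choice hq.
exists (\prod_i q i), (fun i => g i * \prod_(j | j != i) q j); split=> [|i M oM].
  apply: big_ind => [||i _]; [|exact: nonzero_on_squaresM|by have [] := hg i].
  by exists 1%:M; [apply: orthogonal_mx1|rewrite meval1 oner_neq0].
have [_ hi] := hg i.
by rewrite (bigD1 i) //= !mevalM -hi //; ring.
Qed.

(** Exponents of the monomial [x_00 x_0l x_k0 x_kl]; the indices [k] and [l] are lifted to avoid
    0. *)
Definition corner_indicator (k l : 'I_p) (i j : 'I_m) : nat :=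
  ((i == ord0) || (i == lift ord0 k)) && ((j == ord0) || (j == lift ord0 l)).

Lemma prod_pair_indicator (f : 'I_m -> F) (a : 'I_p) (b : pred 'I_m) :
  (forall i, b i = (i == ord0) || (i == lift ord0 a)) ->
  \prod_i f i ^+ b i = f ord0 * f (lift ord0 a).
Proof.
move=> bE; rewrite (bigD1 ord0) //= (bigD1 (lift ord0 a)) //= !bE !eqxx orbT.
rewrite !expr1 [X in _ * (_ * X)]big1 ?mulr1 // => i /andP[i0 ia].
by rewrite bE (negPf i0) (negPf ia).
Qed.

Lemma mxmon_corner k l M : mxmon (corner_indicator k l) M =
  (M ord0 ord0 * M ord0 (lift ord0 l)) * (M (lift ord0 k) ord0 * M (lift ord0 k) (lift ord0 l)).
Proof.
have row (b : bool) (i : 'I_m) : \prod_j M i j ^+ (b && ((j == ord0) || (j == lift ord0 l))) =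
    (M i ord0 * M i (lift ord0 l)) ^+ b.
  case: b => /=; first by rewrite expr1; apply: prod_pair_indicator.
  by rewrite expr0 big1 // => j _; rewrite expr0.
rewrite /mxmon /corner_indicator; under eq_bigr => i _ do rewrite row.
by rewrite (@prod_pair_indicator (fun i => M i ord0 * M i (lift ord0 l)) k).
Qed.

End Squares.

(** * The product of signed sums *)

Section Kummer.
Variables (F : numFieldType) (p : nat).
Local Notation m := p.+1.
Local Notation OM := (@OM F p).
Variable l : 'I_p.
Local Notation l1 := (lift ord0 l : 'I_m).

Definition signed_sum (e : {ffun 'I_m -> bool}) : {mpoly F[m]} := \sum_j (-1) ^+ e j *: 'X_j.

(* This form is even in each variable, except that it is only invariant under
   the simultaneous sign change of the variables [0] and [l]. *)
Definition signed_sums : {mpoly F[m]} :=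
  \prod_(e : {ffun 'I_m -> bool} | e ord0 == e l1) signed_sum e.

Definition sign_vars (d : {ffun 'I_m -> bool}) : m.-tuple {mpoly F[m]} :=
  [tuple (-1) ^+ d j *: 'X_j | j < m].

(** Such a sign change permutes the patterns [e] with [e ord0 = e l1], hence the factors. *)
Lemma signed_sums_invariant (d : {ffun 'I_m -> bool}) : d ord0 = d l1 ->
  signed_sums \mPo sign_vars d = signed_sums.
Proof.
move=> dl; rewrite /signed_sums rmorph_prod /=.
pose h (e : {ffun 'I_m -> bool}) : {ffun 'I_m -> bool} := [ffun j => e j (+) d j].
have hK : involutive h by move=> e; apply/ffunP => j; rewrite !ffunE addbK.
rewrite [RHS](reindex_inj (inv_inj hK)) /=; apply: eq_big => [e|e _].
  by rewrite !ffunE dl; case: (e _); case: (e _); case: (d _).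
rewrite /signed_sum linear_sum; apply: eq_bigr => j _ /=.
by rewrite comp_mpolyZ comp_mpolyXU -tnth_nth tnth_mktuple scalerA ffunE signr_addb.
Qed.

Lemma mcoeff_sign_vars (g : {mpoly F[m]}) d e :
  (g \mPo sign_vars d)@_e = (-1) ^+ (\sum_j d j * e j)%N * g@_e.
Proof.
rewrite comp_mpolyEX raddf_sum /= [in RHS](mpolyE g) raddf_sum /= mulr_sumr.
apply: eq_bigr => a _; rewrite !mcoeffZ mulrCA comp_mpolyX.
have -> : \prod_(i < m) tnth (sign_vars d) i ^+ a i = (-1) ^+ (\sum_j d j * a j)%N *: 'X_[a].
  rewrite mpolyXE_id -prodrXr -scaler_prod; apply: eq_bigr => i _.
  by rewrite tnth_mktuple exprZn exprM.
rewrite mcoeffZ mcoeffX; case: eqP => [->//|_]; by rewrite !mulr0.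
Qed.

Lemma signed_sums_support e (d : {ffun 'I_m -> bool}) : e \in msupp signed_sums ->
  d ord0 = d l1 -> ~~ odd (\sum_j d j * e j).
Proof.
rewrite mcoeff_msupp => e0 /signed_sums_invariant inv.
apply/negP => od; case/eqP: e0.
have := mcoeff_sign_vars signed_sums d e; rewrite inv -signr_odd od expr1 mulN1r.
by move/eqP; rewrite -addr_eq0 -mulr2n -mulr_natl mulf_eq0 pnatr_eq0 => /eqP.
Qed.

(** Invariance under the sign change of a single variable other than [ord0] and [l1] makes its
    exponent even; invariance under the joint change of these two makes their exponents equal in
    parity. *)
Lemma signed_sums_odd e j : e \in msupp signed_sums ->
  odd (e j) = odd (e ord0) && ((j == ord0) || (j == l1)).
Proof.
move=> he.
have sum_in (d : {ffun 'I_m -> bool}) : (\sum_j d j * e j = \sum_(j | d j) e j)%N.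
  rewrite [RHS]big_mkcond; apply: eq_bigr => i _; case: (d i); [exact: mul1n|exact: mul0n].
have [->|j0] := eqVneq j ord0; first by rewrite andbT.
have [jl|jl] := eqVneq j l1.
  have := @signed_sums_support e [ffun i => (i == ord0) || (i == l1)] he.
  rewrite !ffunE !eqxx orbT sum_in => /(_ erefl).
  rewrite (bigD1 ord0) ?ffunE //= (bigD1 l1) ?ffunE ?eqxx ?orbT //= big1 => [|i].
    by rewrite addn0 oddD jl andbT; case: odd; case: odd.
  by rewrite ffunE => /andP[/andP[/orP[]-> //]].
rewrite andbF; apply: negbTE.
have := @signed_sums_support e [ffun i => i == j] he.
rewrite !ffunE !(eq_sym _ j) (negPf j0) (negPf jl) sum_in => /(_ erefl).
by rewrite (big_pred1 j) // => i; rewrite ffunE.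
Qed.

Definition half_mnm (e : 'X_{1..m}) : 'X_{1..m} := [multinom (e j)./2 | j < m].

Definition signed_sums_part (b : bool) : {mpoly F[m]} :=
  \sum_(e <- msupp signed_sums | odd (e ord0) == b) signed_sums@_e *: 'X_[half_mnm e].

Lemma signed_sums_split z : signed_sums.@[z] =
  (signed_sums_part false).@[fun j => z j ^+ 2] +
  z ord0 * z l1 * (signed_sums_part true).@[fun j => z j ^+ 2].
Proof.
have monE e : e \in msupp signed_sums -> 'X_[e].@[z] =
    (z ord0 * z l1) ^+ odd (e ord0) * 'X_[half_mnm e].@[fun j => z j ^+ 2].
  move=> he; rewrite !mevalX.
  have -> : (z ord0 * z l1) ^+ odd (e ord0) = \prod_j z j ^+ odd (e j).
    case oe: (odd (e ord0)) => /=.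
      rewrite expr1 (@prod_pair_indicator _ _ z l (fun j => odd (e j))) // => j.
      by rewrite (signed_sums_odd j he) oe.
    rewrite expr0 big1 // => j _; by rewrite (signed_sums_odd j he) oe.
  rewrite -big_split /=; apply: eq_bigr => j _; rewrite mnmE -exprM -exprD.
  by rewrite mul2n odd_double_half.
rewrite mpoly_meval_sum (bigID (fun e : 'X_{1..m} => odd (e ord0) == false)) /=.
rewrite /signed_sums_part !rmorph_sum /= mulr_sumr; congr (_ + _).
  rewrite big_seq_cond [RHS]big_seq_cond; apply: eq_bigr => e /andP[he /eqP oe].
  by rewrite mevalZ monE // oe expr0 mul1r.
rewrite big_seq_cond [RHS]big_seq_cond; apply: eq_big => [e|e /andP[he /negPf oe]].
  by case: (odd _).
by rewrite mevalZ monE // (_ : odd (e ord0)) ?expr1 1?mulrCA //; case: (odd _) oe.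
Qed.

Variable k : 'I_p.
Local Notation k1 := (lift ord0 k : 'I_m).

Definition row_product (M : 'M[F]_m) (j : 'I_m) : F := M ord0 j * M k1 j.

Lemma orthogonal_mx_tr (M : 'M[F]_m) : OM M -> M *m M^T = 1%:M.
Proof. exact: mulmx1C. Qed.

Lemma signed_sums_row_product M : OM M -> signed_sums.@[row_product M] = 0.
Proof.
move=> oM; rewrite rmorph_prod /=; apply/eqP/prodf_eq0.
exists [ffun => false]; rewrite ?ffunE // rmorph_sum /=.
have := congr1 (fun A : 'M_m => A ord0 k1) (orthogonal_mx_tr oM).
rewrite !mxE /= => h; apply/eqP; rewrite -[RHS]h; apply: eq_bigr => j _.
by rewrite ffunE expr0 mevalZ mul1r mevalXU mxE.
Qed.

(* The witness is the reflection in [2 e_0 + e_l] with the rows [k] and [l]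
   swapped. *)
Lemma row_product_witness : exists2 M, OM M &
  row_product M ord0 != 0 /\
  forall j, row_product M j = row_product M ord0 * ((j == ord0)%:R - (j == l1)%:R).
Proof.
pose v : 'cV[F]_m := \col_j ((j == ord0)%:R * 2 + (j == l1)%:R).
have l0 : (l1 == ord0) = false by [].
have vv : dot v v = 5%:R.
  rewrite /dot mxE (bigD1 ord0) //= (bigD1 l1) //= !mxE !eqxx l0 /= big1 => [|j].
    by rewrite /=; ring.
  by move=> /andP[/negPf j0 /negPf jl]; rewrite !mxE j0 jl /=; ring.
have v0 : dot v v != 0 by rewrite vv pnatr_eq0.
have vE j : v j 0 = (j == ord0)%:R * 2 + (j == l1)%:R by rewrite mxE.
exists (tperm_mx k1 l1 *m refl v).
  apply: orthogonal_mxM; last exact: refl_orthogonal.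
  by rewrite /orthogonal_mx tr_tperm_mx -perm_mxM perm.tperm2 perm_mx1.
have RE j : row_product (tperm_mx k1 l1 *m refl v) j = refl v ord0 j * refl v l1 j.
  by rewrite /row_product -xrowE !mxE perm.tpermL perm.tpermD.
have E0 : row_product (tperm_mx k1 l1 *m refl v) ord0 = 12%:R / 25%:R.
  rewrite RE !refl_entry vv !vE !eqxx l0 /=.
  by field.
split=> [|j]; first by rewrite E0 mulf_neq0 ?invr_eq0 ?pnatr_eq0.
rewrite E0 RE !refl_entry vv !vE !eqxx l0 !(eq_sym _ j).
have [->|j0] := eqVneq j ord0; first by rewrite /= ?(eq_sym ord0) ?l0 /=; field.
have [_|_] := eqVneq j l1; by rewrite /=; field.
Qed.

Lemma square_rational_corner : square_rational (@mxmon F p (corner_indicator k l)).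
Proof.
pose w : m.-tuple {mpoly F[(m * m).+1]} :=
  [tuple 'X_(entry_index ord0 j) * 'X_(entry_index k1 j) | j < m].
have wE b M : (signed_sums_part b \mPo w).@[square_pt M] =
    (signed_sums_part b).@[fun j => row_product M j ^+ 2].
  rewrite comp_mpoly_meval; apply: meval_eq => j.
  by rewrite tnth_mktuple mevalM !mevalXU /square_pt !chart_pt_entry /row_product exprMn.
exists (signed_sums_part true \mPo w), (- (signed_sums_part false \mPo w)); split.
  have [M oM [a0 aE]] := row_product_witness; exists M => //; rewrite wE.
  set a := row_product M ord0 in a0 aE.
  have al : row_product M l1 = - a by rewrite aE eqxx sub0r mulrN1.
  (* The point [z] has the same squares as [row_product M] but the opposite entry at 0. Were
     [signed_sums_part true] zero there, [signed_sums] would vanish at [z] too, while each of its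
     factors at [z] is [2 * a] up to sign. *)
  pose z j := if j == ord0 then - a else row_product M j.
  have z2 : (fun j => z j ^+ 2) = (fun j => row_product M j ^+ 2).
    by apply/funext => j; rewrite /z; case: eqP => // ->; rewrite sqrrN.
  have := signed_sums_row_product oM; rewrite signed_sums_split -/a => h.
  apply/eqP => b0; rewrite b0 mulr0 addr0 in h.
  have : signed_sums.@[z] = 0 by rewrite signed_sums_split z2 h b0 mulr0 addr0.
  rewrite rmorph_prod /= => /eqP/prodf_eq0[e /eqP e0l].
  have zE : (signed_sum e).@[z] = (-1) ^+ e ord0 * (- a) + (-1) ^+ e l1 * (- a).
    rewrite rmorph_sum /= (bigD1 ord0) //= (bigD1 l1) //= big1 => [|j].
      by rewrite addr0 !mevalZ !mevalXU /z eqxx /= al.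
    move=> /andP[/negPf j0 /negPf jl]; rewrite mevalZ mevalXU /z j0 aE j0 jl.
    by rewrite subrr !mulr0.
  by rewrite zE e0l -mulr2n -mulr_natl !mulf_eq0 pnatr_eq0 signr_eq0 oppr_eq0 (negPf a0).
move=> M oM; rewrite mevalN !wE mxmon_corner; apply/eqP; rewrite -subr_eq0 opprK; apply/eqP.
by rewrite -(signed_sums_row_product oM) signed_sums_split /row_product; ring.
Qed.

End Kummer.

(** * Comparison of the Hilbert functions of O(m) and of the squares *)

Section Comparison.
Variables (F : numFieldType) (p : nat).
Local Notation m := p.+1.
Local Notation OM := (@OM F p).
Implicit Types (M : 'M[F]_m) (E : 'I_m -> 'I_m -> nat).

Definition corner_sum E i j : nat :=
  \sum_k \sum_l E (lift ord0 k) (lift ord0 l) * corner_indicator k l i j.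

Lemma mxmon_sum (I : finType) (f : I -> nat) (E : I -> 'I_m -> 'I_m -> nat) M :
  mxmon (fun i j => \sum_a f a * E a i j)%N M = \prod_a mxmon (E a) M ^+ f a.
Proof.
transitivity (\prod_i \prod_j \prod_a (M i j ^+ E a i j) ^+ f a).
  apply: eq_bigr => i _; apply: eq_bigr => j _; rewrite -prodrXr.
  by apply: eq_bigr => a _; rewrite mulnC exprM.
under eq_bigr => i _ do rewrite exchange_big /=.
rewrite exchange_big /=; apply: eq_bigr => a _; rewrite /mxmon -prodrXl.
by apply: eq_bigr => i _; rewrite -prodrXl.
Qed.

Lemma square_rational_corner_sum E : square_rational (@mxmon F p (corner_sum E)).
Proof.
pose u M := \prod_(kl : 'I_p * 'I_p)
  mxmon (corner_indicator kl.1 kl.2) M ^+ E (lift ord0 kl.1) (lift ord0 kl.2).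
apply: (eq_square_rational (u := u)).
  move=> M _; rewrite /u -mxmon_sum /mxmon; apply: eq_bigr => i _; apply: eq_bigr => j _.
  by rewrite /corner_sum pair_big.
apply: square_rational_prod => kl; apply: square_rationalX.
exact: square_rational_corner.
Qed.

Lemma sum_pair_indicator (f : 'I_p -> nat) (i : 'I_m) :
  (\sum_k f k * ((i == ord0) || (i == lift ord0 k)) =
   if unlift ord0 i is Some k then f k else \sum_k f k)%N.
Proof.
case: unliftP => [k|] -> /=.
  rewrite (bigD1 k) //= eqxx /= muln1 big1 ?addn0 // => k' ne.
  by rewrite (inj_eq lift_inj) eq_sym (negPf ne) muln0.
by apply: eq_bigr => k _; rewrite muln1.
Qed.

Lemma parity_col c E : @parity p (inl c) E = (\sum_i E i c)%N.
Proof.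
rewrite /parity exchange_big (bigD1 c) //= [X in (_ + X)%N]big1 ?addn0 => [|j /negPf ne].
  by apply: eq_bigr => i _; rewrite eqxx mul1n.
by rewrite big1 // => i _; rewrite ne.
Qed.

Lemma parity_row r E : @parity p (inr r) E = (\sum_j E (lift ord0 r) j)%N.
Proof.
rewrite /parity (bigD1 (lift ord0 r)) //= [X in (_ + X)%N]big1 ?addn0 => [|j /negPf ne].
  by apply: eq_bigr => i _; rewrite eqxx mul1n.
by rewrite big1 // => i _; rewrite ne.
Qed.

(** Outside row and column 0 the two terms are equal. On the border, [corner_sum E] is a partial row
    or column sum of [E], or at the corner a double one, and evenness of the full sums gives it the
    parity of the entry of [E]. *)
Lemma odd_corner_sum E : (forall x, ~~ odd (@parity p x E)) ->
  forall i j, ~~ odd (E i j + corner_sum E i j).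
Proof.
move=> evE.
have colE (c : 'I_m) : odd (\sum_i E i c) = false.
  by apply: negbTE; rewrite -parity_col evE.
have rowE (r : 'I_p) : odd (\sum_j E (lift ord0 r) j) = false.
  by apply: negbTE; rewrite -parity_row evE.
have colE0 (c : 'I_m) : odd (\sum_k E (lift ord0 k) c) = odd (E ord0 c).
  have := colE c; rewrite big_ord_recl oddD; by case: odd; case: odd.
have rowE0 (r : 'I_p) : odd (\sum_l E (lift ord0 r) (lift ord0 l)) = odd (E (lift ord0 r) ord0).
  have := rowE r; rewrite big_ord_recl oddD; by case: odd; case: odd.
have csE i j : corner_sum E i j = (\sum_k (\sum_l E (lift ord0 k) (lift ord0 l) *
    ((j == ord0) || (j == lift ord0 l))) * ((i == ord0) || (i == lift ord0 k)))%N.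
  apply: eq_bigr => k _; rewrite big_distrl; apply: eq_bigr => l _.
  by rewrite /corner_indicator andbC -mulnb mulnA.
have odd_sum (I : finType) (f g : I -> nat) : (forall a, odd (f a) = odd (g a)) ->
    odd (\sum_a f a) = odd (\sum_a g a).
  move=> fg; apply: (big_ind2 (fun a b => odd a = odd b)) => // a b c d.
  by rewrite !oddD => -> ->.
move=> i j; rewrite csE.
under eq_bigr => k _ do rewrite sum_pair_indicator.
rewrite (sum_pair_indicator (fun k => if unlift ord0 j is Some l then
  E (lift ord0 k) (lift ord0 l) else \sum_l E (lift ord0 k) (lift ord0 l))%N).
rewrite oddD; case: unliftP => [k|] ->; case: unliftP => [l|] ->.
- by rewrite addbb.
- by rewrite rowE0 addbb.
- by rewrite colE0 addbb.
rewrite (odd_sum _ _ (fun k => E (lift ord0 k) ord0)) ?colE0 ?addbb //.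
Qed.

(** [mxmon E * mxmon (corner_sum E)] is a monomial in the squares. A second factor
    [mxmon (corner_sum E)] turns the one on the left into a square and leaves a product of corners
    on the right. *)
Lemma square_rational_mxmon E : (forall x, ~~ odd (@parity p x E)) ->
  square_rational (@mxmon F p E).
Proof.
move=> evE; pose H i j := ((E i j + corner_sum E i j)./2).
apply: (square_rational_div (y := mxmon_mpoly F (corner_sum E))
  (w := fun M => (mxmon_mpoly F H).@[square_pt M] * mxmon (corner_sum E) M)).
- exact: nonzero_on_squares_mxmon.
- move=> M _; rewrite !in_squares_mxmon expr2 mulrAC; congr (_ * _).
  rewrite mulrC -mxmonD /mxmon -prodrXl; apply: eq_bigr => i _; rewrite -prodrXl.
  apply: eq_bigr => j _; rewrite -exprM muln2 /H -[in LHS](odd_double_half (_ + _)%N).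
  by rewrite (negPf (odd_corner_sum evE _ _)).
- by apply: square_rationalM; [apply: square_rational_mpoly|apply: square_rational_corner_sum].
Qed.

(** A monomial in the entries of row 0 and column 0 with character [chi]. The bits of the rows are
    repeated at the corner to cancel in the parity of column 0. *)
Definition character_exponents (chi : {set sign_index p}) (i j : 'I_m) : nat :=
  match unlift ord0 i, unlift ord0 j with
  | None, None => (inl ord0 \in chi) + \sum_r (inr r \in chi)
  | Some r, None => inr r \in chi
  | None, Some _ => inl j \in chi
  | Some _, Some _ => 0
  end.

Lemma character_exponentsK chi : character (character_exponents chi) = chi.
Proof.
have E0 j : character_exponents chi ord0 j = (if unlift ord0 j is Some _ then
    (inl j \in chi) : nat else (inl ord0 \in chi) + \sum_r (inr r \in chi))%N.
  by rewrite /character_exponents unlift_none; case: unlift.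
have Er r j : character_exponents chi (lift ord0 r) j =
    (if unlift ord0 j is Some _ then 0 else inr r \in chi)%N.
  by rewrite /character_exponents liftK; case: unlift.
apply/setP => -[c|r]; rewrite inE ?parity_col ?parity_row big_ord_recl.
  rewrite E0 (eq_bigr _ (fun r _ => Er r c)); case: unliftP => [l ->|->].
    by rewrite big1 // addn0 oddb.
  by rewrite -addnA addnn oddD odd_double addbF oddb.
by rewrite Er unlift_none big1 ?addn0 ?oddb // => l _; rewrite Er liftK.
Qed.

Definition squares_set : set ('I_(m * m).+1 -> F) := (@square_pt F p @` OM)%classic.

Lemma squares_set0 y : squares_set y -> y ord0 = 1.
Proof. by move=> [M _ <-]; rewrite /square_pt chart_pt0 expr1n. Qed.

Local Notation chi_mpoly chi := (mxmon_mpoly F (character_exponents chi)).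

Lemma chi_mpolyE chi M : (chi_mpoly chi).@[chart_pt M] = mxmon (character_exponents chi) M.
Proof. exact: mxmon_mpolyE. Qed.

Lemma semi_chi_mpoly chi : semi_invariant chi (fun M => (chi_mpoly chi).@[chart_pt M]).
Proof.
apply: (eq_semi_invariant (u := mxmon (character_exponents chi))).
  by move=> M; rewrite chi_mpolyE.
by rewrite -{1}[chi]character_exponentsK; apply: semi_mxmon.
Qed.

Lemma card_sign_sets : #|{: {set sign_index p}}| = (2 ^ (2 * p + 1))%N.
Proof.
rewrite -cardsT -powersetT card_powerset cardsT card_sum !card_ord.
by congr (_ ^ _)%N; lia.
Qed.

(** A basis of forms in the squares is multiplied by one monomial for each character. The characters
    separate the products for distinct [chi], and for one [chi] the monomial can be cancelled. The
    shift [b] makes room for its degree. *)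
Theorem hilb_squares_lower : exists b, forall t,
  (2 ^ (2 * p + 1) * hilb squares_set t <= hilb (pts OM) (2 * (t + b)))%N.
Proof.
pose d (chi : {set sign_index p}) := (\sum_i \sum_j character_exponents chi i j)%N.
exists (\max_chi d chi)%N => t; set b := (\max_chi _)%N.
have [g [hg ig _]] := form_basis_exists squares_set t.
rewrite -card_sign_sets -[hilb squares_set t]card_ord -card_prod.
apply: (hilb_geq (p := fun cj => chi_mpoly cj.1 * in_squares (g cj.2))).
- exact: pts_chart0.
- move=> [chi j] /=.
  have h : deg_le (chi_mpoly chi * in_squares (g j)) (d chi + t * 2).
    apply: deg_leM; first exact: deg_mxmon_mpoly.
    by apply: deg_in_squares; apply: dhomog_msize_le.
  apply: leq_trans h _; rewrite ltnS.
  have : (d chi <= b)%N by apply: leq_bigmax.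
  by lia.
move=> c c0.
pose G chi := \sum_j c (chi, j) *: g j.
have GE chi M : \sum_j c (chi, j) * (chi_mpoly chi * in_squares (g j)).@[chart_pt M] =
    (chi_mpoly chi).@[chart_pt M] * (in_squares (G chi)).@[chart_pt M].
  rewrite in_squaresE [in RHS]rmorph_sum /= mulr_sumr; apply: eq_bigr => j _.
  by rewrite mevalM in_squaresE mevalZ mulrCA.
have semiG chi : exists psi, semi_invariant psi (fun M =>
    (chi_mpoly chi).@[chart_pt M] * (in_squares (G chi)).@[chart_pt M]).
  exact: semi_invariantM (@semi_chi_mpoly chi) (semi_in_squares _).
have sG chi : semi_invariant chi (fun M =>
    (chi_mpoly chi).@[chart_pt M] * (in_squares (G chi)).@[chart_pt M]).
  move=> x M oM; rewrite semi_chi_mpoly // (semi_in_squares (G chi)) // inE expr0 mul1r.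
  by rewrite mulrA.
have G0 chi M : OM M -> (chi_mpoly chi).@[chart_pt M] * (in_squares (G chi)).@[chart_pt M] = 0.
  move: chi M; apply: semi_invariant_separate sG _ => M oM.
  rewrite -[RHS](c0 (chart_pt M)); last by exists M.
  rewrite (eq_bigr _ (fun chi _ => esym (GE chi M))) pair_big /=.
  by apply: eq_bigr => -[chi j].
move=> [chi j]; move: j; apply: ig => y [M oM <-].
have := semi_invariant_prime (@semi_chi_mpoly chi) (semi_in_squares (G chi)) _ (G0 chi) oM.
rewrite in_squaresE rmorph_sum /= => h; rewrite -[RHS]h.
  by apply: eq_bigr => j _; rewrite mevalZ.
have [N oN nz] := mxmon_nonzero F (character_exponents chi).
by exists N => //; rewrite chi_mpolyE.
Qed.

Definition character_part (chi : {set sign_index p}) (f : {mpoly F[(m * m).+1]}) :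
    {mpoly F[(m * m).+1]} :=
  \sum_(A <- msupp f | character (mx_exponents A) == chi) f@_A *: 'X_[A].

Lemma sum_character_part f : \sum_chi character_part chi f = f.
Proof.
rewrite [RHS]mpolyE /character_part.
under eq_bigr => chi _ do rewrite big_mkcond /=.
rewrite exchange_big /=; apply: eq_bigr => A _.
by rewrite -big_mkcond /= (big_pred1 (character (mx_exponents A))) // => chi; rewrite eq_sym.
Qed.

Lemma semi_character_part chi f : semi_invariant chi (fun M => (character_part chi f).@[chart_pt M]).
Proof.
move=> x M oM; rewrite !rmorph_sum /= mulr_sumr; apply: eq_bigr => A /eqP <-.
by rewrite !mevalZ !meval_monomial mxmon_flip sign_parity mulrCA.
Qed.

(** A monomial is a squarefree one, given by the parities of its exponents, times a monomial in the
    squares. Multiplied by the monomial of its character, the squarefree factor becomes rational in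
    the squares; [q] is a common denominator for these finitely many functions, and [b] bounds the
    degrees of the numerators. *)
Theorem hilb_squares_upper : exists b, forall t,
  (hilb (pts OM) (2 * t) <= 2 ^ (2 * p + 1) * hilb squares_set (t + b))%N.
Proof.
pose bits := {ffun 'I_m * 'I_m -> bool}.
pose Eb (e : bits) i j : nat := e (i, j).
pose W (e : bits) M := mxmon (Eb e) M * mxmon (character_exponents (character (Eb e))) M.
have [q [g [q0 qg]]] : exists q (g : bits -> {mpoly F[(m * m).+1]}), nonzero_on_squares q /\
    forall e M, OM M -> q.@[square_pt M] * W e M = (g e).@[square_pt M].
  apply: square_rational_common => e; rewrite /W.
  apply: (eq_square_rational (u := mxmon (fun i j =>
    Eb e i j + character_exponents (character (Eb e)) i j)%N)) => [M _|]; first exact: mxmonD.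
  apply: square_rational_mxmon => x; rewrite parityD oddD.
  have : (x \in character (Eb e)) = (x \in character (character_exponents (character (Eb e)))).
    by rewrite character_exponentsK.
  by rewrite [X in X = _]inE [X in _ = X]inE => ->; rewrite addbb.
exists (\max_e msize (g e))%N => t; set b := (\max_e _)%N.
have [f [hf if_ _]] := form_basis_exists (pts OM) (2 * t).
have [h [hh ih sh]] := form_basis_exists squares_set (t + b).
(* A function on pairs [(chi, M)] is a family of functions on [OM], one for each character, so that
   a single dimension count treats all isotypic parts. *)
pose D : set ({set sign_index p} * 'M[F]_m) := [set z | OM z.2]%classic.
rewrite -card_sign_sets -[hilb (pts OM) _]card_ord -[hilb squares_set _]card_ord -card_prod.
pose V chi M := q.@[square_pt M] * (chi_mpoly chi).@[chart_pt M].
pose P i (z : {set sign_index p} * 'M[F]_m) :=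
  V z.1 z.2 * (character_part z.1 (f i)).@[chart_pt z.2].
pose G (cj : {set sign_index p} * 'I_(hilb squares_set (t + b))) (z : {set sign_index p} * 'M[F]_m) :=
  (cj.1 == z.1)%:R * (h cj.2).@[square_pt z.2].
have spanA A chi : mdeg A = (2 * t)%N -> character (mx_exponents A) = chi ->
    exists c : 'I_(hilb squares_set (t + b)) -> F, forall M, OM M ->
    V chi M * 'X_[A].@[chart_pt M] = \sum_j c j * (h j).@[square_pt M].
  move=> dA cA; pose e : bits := [ffun ij => odd (mx_exponents A ij.1 ij.2)].
  pose H i j := (mx_exponents A i j)./2.
  have eA : character (Eb e) = chi.
    rewrite -cA; apply/setP => x; rewrite !inE /parity.
    apply: (big_ind2 (fun a b => odd a = odd b)) => // [a a' c c'|i _]; first by rewrite !oddD => -> ->.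
    apply: (big_ind2 (fun a b => odd a = odd b)) => // [a a' c c'|j _]; first by rewrite !oddD => -> ->.
    by rewrite /Eb ffunE !oddM !oddb.
  have deg : (msize (g e * mxmon_mpoly F H) <= (t + b).+1)%N.
    have le1 : deg_le (g e) b by rewrite /deg_le leqW //; apply: leq_bigmax.
    have := deg_leM le1 (deg_mxmon_mpoly F H); rewrite /deg_le => le2; apply: leq_trans le2 _.
    rewrite ltnS addnC leq_add2r -(leq_pmul2l (m := 2)) // -dA.
    apply: leq_trans (mx_exponents_leq A).
    rewrite big_distrr leq_sum //= => i _; rewrite big_distrr leq_sum //= => j _.
    by rewrite mul2n -[X in (_ <= X)%N](odd_double_half (mx_exponents A i j)) leq_addl.
  have [u hu uE] := homogenize deg; have [c hc] := sh _ hu; exists c => M oM.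
  have sM : squares_set (square_pt M) by exists M.
  rewrite -hc // uE ?mevalM; last exact: squares_set0.
  rewrite -qg // in_squares_mxmon /W /V chi_mpolyE eA meval_monomial -!mulrA; congr (_ * _).
  rewrite [RHS]mulrCA; congr (_ * _); rewrite /mxmon -prodrXl -big_split /=; apply: eq_bigr => i _.
  rewrite -prodrXl -big_split /=; apply: eq_bigr => j _.
  by rewrite -exprM -exprD /Eb ffunE muln2 odd_double_half.
have spanP i : spanned D G (P i).
  apply: (spanned_eq (w' := fun z => \sum_(A <- msupp (f i)) (f i)@_A *
     ((character (mx_exponents A) == z.1)%:R * (V z.1 z.2 * 'X_[A].@[chart_pt z.2])))).
    move=> z _; rewrite /P /character_part rmorph_sum /= mulr_sumr big_mkcond /=.
    apply: eq_bigr => A _; case: eqP => _; last by rewrite mul0r mulr0.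
    by rewrite mevalZ mul1r mulrCA.
  apply: spanned_sum => A Af; have dA := dhomog_mf (hf i) Af.
  have [c hc] := @spanA A _ dA erefl.
  exists (fun cj => (cj.1 == character (mx_exponents A))%:R * c cj.2) => -[chi M] /= oM.
  rewrite -(pair_big xpredT xpredT (fun chi' j => (chi' == character (mx_exponents A))%:R * c j *
    G (chi', j) (chi, M))) /=.
  rewrite (bigD1 (character (mx_exponents A))) //= [X in _ + X]big1 ?addr0 => [|chi' /negPf ne]; last first.
    by rewrite big1 // => j _; rewrite ne !mul0r.
  rewrite /G /=; case: eqP => [<-|_]; last by rewrite mul0r big1 // => j _; rewrite mul0r mulr0.
  by rewrite mul1r hc //; apply: eq_bigr => j _; rewrite eqxx !mul1r.
apply: indep_leq_spanned spanP => c c0.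
pose S chi := \sum_i c i *: character_part chi (f i).
have SE chi M : \sum_i c i * P i (chi, M) = V chi M * (S chi).@[chart_pt M].
  rewrite rmorph_sum /= mulr_sumr; apply: eq_bigr => i _.
  by rewrite mevalZ /P /= mulrCA.
have semiS chi : semi_invariant chi (fun M => (S chi).@[chart_pt M]).
  move=> x M oM; rewrite !rmorph_sum /= mulr_sumr; apply: eq_bigr => i _.
  by rewrite !mevalZ semi_character_part // mulrCA.
(* [V chi] is a semi-invariant function that is not identically zero, so it can be cancelled from
   the relation in each isotypic part. *)
have S0 chi M : OM M -> (S chi).@[chart_pt M] = 0.
  have [psi sV] := semi_invariantM (semi_in_squares q) (@semi_chi_mpoly chi).
  have VE N : (in_squares q * chi_mpoly chi).@[chart_pt N] = V chi N.
    by rewrite mevalM in_squaresE.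
  have sV' : semi_invariant psi (fun N => (in_squares q * chi_mpoly chi).@[chart_pt N]).
    by apply: eq_semi_invariant sV => N; rewrite mevalM.
  apply: (semi_invariant_prime sV' (semiS chi)) => [|N oN]; last first.
    by rewrite VE -SE; apply: c0.
  have [||N oN nz] := semi_invariant_nonzeroM (semi_in_squares q) (@semi_chi_mpoly chi).
  - by have [N oN nz] := q0; exists N => //; rewrite in_squaresE.
  - by have [N oN nz] := mxmon_nonzero F (character_exponents chi); exists N => //; rewrite chi_mpolyE.
  by exists N => //; rewrite mevalM.
apply: if_ => y [M oM <-].
transitivity (\sum_chi (S chi).@[chart_pt M]); last by apply: big1 => chi _; apply: S0.
transitivity (\sum_chi \sum_i c i * (character_part chi (f i)).@[chart_pt M]); last first.
  by apply: eq_bigr => chi _; rewrite rmorph_sum; apply: eq_bigr => i _; rewrite /= mevalZ.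
rewrite exchange_big /=; apply: eq_bigr => i _; rewrite -mulr_sumr; congr (_ * _).
by rewrite -{1}[f i]sum_character_part rmorph_sum.
Qed.

End Comparison.

(** * Zariski closures and coordinate-wise squares *)

Section Closure.
Variables (F : fieldType) (N : nat).
Implicit Type X : set (pspace F N).

Lemma zariski_closureP X q : zariski_closure X q <->
  forall d (f : {mpoly F[N.+1]}), f \is d.-homog -> vanishes_on f X -> form_vanishes f q.
Proof.
split=> [h d f hf fX|h Z [[S [hS ->]] XZ] f Sf].
  apply: (h [set q | forall g, [set f]%classic g -> form_vanishes g q]%classic) => //.
  split; last by move=> r Xr g ->; apply: fX.
  by exists [set f]%classic; split=> // g ->; exists d.
have [d hf] := hS f Sf; apply: (h d) => // r /XZ; exact.
Qed.

Lemma vanishes_on_closure d (f : {mpoly F[N.+1]}) X : f \is d.-homog ->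
  vanishes_on f (zariski_closure X) <-> vanishes_on f X.
Proof.
move=> hf; split=> h q Xq; first by apply: h; apply/zariski_closureP => d' g _; apply.
exact: (iffLR (zariski_closureP _ _) Xq d f hf h).
Qed.

Lemma zariski_closureS X X' : (X `<=` X')%classic -> (zariski_closure X `<=` zariski_closure X')%classic.
Proof.
move=> sub q /zariski_closureP h; apply/zariski_closureP => d f hf fX; apply: h hf _.
by move=> r /sub; apply: fX.
Qed.

Lemma dhomog_prod_sum n (I : Type) (r : seq I) (f : I -> {mpoly F[n]}) d :
  (forall i, f i \is (d i).-homog) -> \prod_(i <- r) f i \is (\sum_(i <- r) d i).-homog.
Proof.
move=> h; elim: r => [|i r IH]; first by rewrite !big_nil; apply: dhomog1.
by rewrite !big_cons; apply: dhomogM.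
Qed.

Lemma dhomog_comp n k (g : {mpoly F[n]}) (w : n.-tuple {mpoly F[k]}) b d :
  (forall i, tnth w i \is b.-homog) -> g \is d.-homog -> (g \mPo w) \is (b * d)%N.-homog.
Proof.
move=> hw /dhomogP hg; rewrite comp_mpolyEX big_seq; apply: rpred_sum => e ge; apply: rpredZ.
rewrite comp_mpolyX -(hg e ge : mdeg e = d) mdegE big_distrr /=.
by apply: dhomog_prod_sum => i; apply: dhomogMn.
Qed.

Lemma vanishes_on_coordwise_square d (f : {mpoly F[N.+1]}) X : f \is d.-homog ->
  vanishes_on f (coordwise_power 2 X) <-> vanishes_on (in_squares f) X.
Proof.
move=> hf.
have E q : form_vanishes f (coordpow 2 q) <-> form_vanishes (in_squares f) q.
  rewrite /coordpow (form_vanishesE _ hf) /form_vanishes /in_squares comp_mpoly_meval.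
  rewrite (@meval_eq _ _ (fun i => (tnth (square_vars F N.+1) i).@[hcoord q]) (val (powvec 2 (repr q)) 0)) // => i.
  by rewrite tnth_mktuple rmorphXn /= mevalXU mxE.
by split=> [h q Xq|h _ [q Xq <-]]; apply/E/h => //; exists q.
Qed.

End Closure.

(** * O(m) and SO(m) in projective space *)

Section Orthogonal.
Local Open Scope quotient_scope.
Variables (F : numFieldType) (p : nat).
Local Notation m := p.+1.

Lemma form_vanishes_chart d (f : {mpoly F[(m * m).+1]}) (M : 'M[F]_m) : f \is d.-homog ->
  form_vanishes f (chart M) <-> f.@[chart_pt M] = 0.
Proof.
exact: (form_vanishesE (exist (fun w : 'rV[F]_(m * m).+1 => w != 0) _ (chart_vec_neq0 M))).
Qed.

Lemma vanishes_on_chart d (f : {mpoly F[(m * m).+1]}) (Y : set 'M[F]_m) : f \is d.-homog ->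
  vanishes_on f (@chart F m @` Y)%classic <-> forall y, pts Y y -> f.@[y] = 0.
Proof.
move=> hf; split=> [h y [M YM <-]|h _ [M YM <-]].
  by apply/(form_vanishes_chart M hf)/h; exists M.
by apply/(form_vanishes_chart M hf)/h; exists M.
Qed.

Lemma hilbert_fun_OO t : hilbert_fun (OO F m) t = hilb (pts (@OM F p)) t.
Proof.
apply: hilbert_funE => f hf.
exact: iff_trans (vanishes_on_closure _ hf) (vanishes_on_chart _ hf).
Qed.

Lemma dhomog_in_squares n d (f : {mpoly F[n]}) : f \is d.-homog ->
  in_squares f \is (2 * d)%N.-homog.
Proof.
apply: dhomog_comp => i; rewrite tnth_mktuple.
by apply: (@dhomogMn _ _ _ 1%N); rewrite dhomogX; apply/eqP/mdeg1.
Qed.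

Lemma hilbert_fun_square_OO t :
  hilbert_fun (coordwise_power 2 (OO F m)) t = hilb (@squares_set F p) t.
Proof.
apply: hilbert_funE => f hf; have hs := dhomog_in_squares hf.
apply: iff_trans (vanishes_on_coordwise_square _ hf) _.
apply: iff_trans (vanishes_on_closure _ hs) _.
apply: iff_trans (vanishes_on_chart _ hs) _; split=> [h _ [M oM <-]|h _ [M oM <-]].
  by rewrite -in_squaresE; apply: h; exists M.
by rewrite in_squaresE; apply: h; exists M.
Qed.

Lemma det_flip (M : 'M[F]_m) : \det (flip (inl ord0) M) = - \det M.
Proof.
have -> : flip (inl ord0) M = M *m diag_mx (\row_j (-1) ^+ (j == ord0)).
  apply/matrixP => i j; rewrite !mxE (bigD1 j) //= big1 ?addr0 => [|k /negPf kj].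
    by rewrite !mxE eqxx mulr1n mulrC.
  by rewrite !mxE kj mulr0n mulr0.
rewrite det_mulmx det_diag big_ord_recl mxE eqxx expr1 big1 ?mulr1 ?mulrN1 // => i _.
by rewrite mxE expr0.
Qed.

Lemma det_orthogonal (M : 'M[F]_m) : orthogonal_mx M -> \det M = 1 \/ \det M = -1.
Proof.
move=> /(congr1 determinant); rewrite det_mulmx det_tr det1 -expr2 => /eqP.
by rewrite sqrf_eq1 => /orP[]/eqP; [left|right].
Qed.

(** The sign change of column 0 as a vector of signs, which lets it act on all homogeneous
    coordinates, also at points outside the chart. *)
Definition column_signs : 'I_(m * m).+1 -> F := chart_pt (flip (inl ord0) (const_mx 1)).

Lemma column_signsE (M : 'M[F]_m) i :
  chart_pt (flip (inl ord0) M) i = column_signs i * chart_pt M i.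
Proof.
move: i; apply: chart_index_ind => [|i j]; rewrite /column_signs ?chart_pt0 ?mul1r //.
by rewrite !chart_pt_entry !mxE mulr1.
Qed.

Lemma column_signs_sqr i : column_signs i ^+ 2 = 1.
Proof.
move: i; apply: chart_index_ind => [|i j]; rewrite /column_signs ?chart_pt0 ?expr1n //.
by rewrite chart_pt_entry !mxE mulr1 sqrr_sign.
Qed.

Lemma signed_vec_neq0 (v : nzvec F (m * m)) : \row_i (column_signs i * val v 0 i) != 0.
Proof.
apply: contraNneq (valP v) => h; apply/eqP/rowP => i.
have := congr1 (fun w : 'rV_(m * m).+1 => w 0 i) h; rewrite !mxE => /eqP.
rewrite mulf_eq0 => /orP[/eqP s0|/eqP //].
by have := column_signs_sqr i; rewrite s0 expr0n => /eqP; rewrite eq_sym oner_eq0.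
Qed.

Definition signed_vec (v : nzvec F (m * m)) : nzvec F (m * m) :=
  exist (fun w : 'rV[F]_(m * m).+1 => w != 0) _ (signed_vec_neq0 v).

(** The closure of O(m) is the union of the closure of SO(m) and its image under a column sign
    change, which squaring does not see. For a point [q] of [OO] outside both, a form [f] that
    detects this for [SO] and a form [g'] that detects it for the image would have a product that
    vanishes on O(m) but not at [q]. *)
Lemma coordwise_square_OO : coordwise_power 2 (OO F m) = coordwise_power 2 (SO F m).
Proof.
apply/seteqP; split=> _ [q Oq <-]; last first.
  by exists q => //; apply: zariski_closureS Oq => _ [M [oM _] <-]; exists M.
pose r := \pi_(pspace F (m * m)) (signed_vec (repr q)).
have rq : coordpow 2 r = coordpow 2 q.
  rewrite coordpowE /coordpow; congr (\pi_(pspace F (m * m)) _).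
  by apply: val_inj; apply/rowP => i; rewrite !mxE exprMn column_signs_sqr mul1r.
suff [Sq|Sr] : SO F m q \/ SO F m r by [exists q|exists r].
apply: contrapT => /not_orP[nq nr].
have [d [f [hf fS fq]]] : exists d (f : {mpoly F[(m * m).+1]}), [/\ f \is d.-homog,
    vanishes_on f (@chart F m @` [set M | orthogonal_mx M /\ \det M = 1])%classic &
    ~ form_vanishes f q].
  apply: contrapT => no; apply: nq; apply/zariski_closureP => d f hf fS.
  by apply: contrapT => fq; apply: no; exists d, f.
have [e [g [hg gS gr]]] : exists d (f : {mpoly F[(m * m).+1]}), [/\ f \is d.-homog,
    vanishes_on f (@chart F m @` [set M | orthogonal_mx M /\ \det M = 1])%classic &
    ~ form_vanishes f r].
  apply: contrapT => no; apply: nr; apply/zariski_closureP => e g hg gS.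
  by apply: contrapT => gr; apply: no; exists e, g.
pose g' := g \mPo [tuple column_signs i *: 'X_i | i < (m * m).+1].
have hg' : g' \is (1 * e)%N.-homog.
  by apply: dhomog_comp hg => i; rewrite tnth_mktuple rpredZ // dhomogX; apply/eqP/mdeg1.
have g'E v : g'.@[v] = g.@[fun i => column_signs i * v i].
  by rewrite comp_mpoly_meval; apply: meval_eq => i; rewrite tnth_mktuple mevalZ mevalXU.
have fg : form_vanishes (f * g') q.
  apply: (iffLR (zariski_closureP _ _) Oq) (dhomogM hf hg') _.
  apply/(vanishes_on_chart _ (dhomogM hf hg')) => _ [M oM <-].
  rewrite mevalM g'E; have [dM|dM] := det_orthogonal oM.
    by rewrite (iffLR (vanishes_on_chart _ hf) fS) ?mul0r //; exists M.
  rewrite (@meval_eq _ _ (fun i => column_signs i * chart_pt M i) (chart_pt (flip (inl ord0) M)) g);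
    last by move=> i; rewrite column_signsE.
  rewrite (iffLR (vanishes_on_chart _ hg) gS) ?mulr0 //.
  exists (flip (inl ord0) M) => //; split; first exact: flip_orthogonal.
  by rewrite det_flip dM opprK.
move: fg; rewrite /form_vanishes mevalM => /eqP; rewrite mulf_eq0 => /orP[]/eqP; first exact: fq.
rewrite g'E => g0; apply: gr; apply/(form_vanishesE _ hg); rewrite -g0.
by apply: meval_eq => i; rewrite mxE.
Qed.

End Orthogonal.

(** * Comparison of degrees *)

Theorem degree_square_OO (F : numFieldType) (p : nat) (m := p.+1) :
  proj_degree (coordwise_power 2 (OO F m)) * 2 ^+ (2 * p + 1) =
    2 ^+ 'C(m, 2) * proj_degree (OO F m) /\
  proj_degree (OO F m) <= 2 ^+ 'C(m.+1, 2).
Proof.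
set d := 'C(m, 2); set N := (2 * p + 1)%N.
have [P [hP sP bP]] := orthogonal_bound F p.
have [Q hQ] := hilb_eventually_poly (@squares_set F p).
have P0 := eventually_poly_ge0 hP; have Q0 := eventually_poly_ge0 hQ.
(* The Cayley bound [(t + 1) ^ d <= P(c t)] shows that the dimension is exactly [d], so that the
   coefficient at [d] is the leading one. *)
have dP : (d.+1 <= size P)%N.
  have [c c0 le] := orthogonal_lower F p.
  have sc : size (c%:R *: 'X : {poly rat}) = 2 by rewrite size_scale ?size_polyX // pnatr_eq0 -lt0n.
  rewrite -(size_comp_poly2 P sc) -(size_exp_XsubC d (-1 : rat)).
  apply: growth_size; first by exists 0%N => t _; rewrite !hornerE opprK exprn_ge0 // addr_ge0.
  case: hP => t0 h; exists t0 => t tt; rewrite horner_comp !hornerE -natrM h.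
    by rewrite opprK -[1]/(1%:R) -natrD addn1 -natrX ler_nat le.
  by apply: leq_trans tt _; rewrite leq_pmull.
have {dP}sP : size P = d.+1 by apply/eqP; rewrite eqn_leq sP.
have size_lin b : size (2 *: 'X + b%:R%:P : {poly rat}) = 2.
  rewrite size_polyDl size_scale ?size_polyX ?pnatr_eq0 //.
  exact: leq_ltn_trans (size_polyC_leq1 _) _.
have lead_lin b : lead_coef (2 *: 'X + b%:R%:P : {poly rat}) = 2.
  rewrite lead_coefDl; first by rewrite lead_coefZ lead_coefX mulr1.
  rewrite size_scale ?size_polyX ?pnatr_eq0 //.
  exact: leq_ltn_trans (size_polyC_leq1 _) _.
have size_dil b : size (P \Po (2 *: 'X + b%:R%:P)) = d.+1 by rewrite size_comp_poly2.
have coef_dil b : (P \Po (2 *: 'X + b%:R%:P))`_d = lead_coef P * 2 ^+ d.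
  have := lead_coef_comp P (q := 2 *: 'X + b%:R%:P).
  by rewrite size_lin lead_lin sP {1}lead_coefE size_dil => ->.
have [b lo] : exists b, eventually (fun t => (2 ^+ N *: Q).[t%:R] <= (P \Po (2 *: 'X + b%:R%:P)).[t%:R]).
  have [b le] := hilb_squares_lower F p; exists (2 * b)%N.
  have [t0 h] := hP; have [t1 h'] := hQ; exists (maxn t0 t1) => t; rewrite geq_max => /andP[tt0 tt1].
  rewrite horner_comp !hornerE h' // -!natrM -natrD -mulnDr h; last by lia.
  by rewrite -natrX -natrM ler_nat.
have [b' up] : exists b, eventually (fun t => (P \Po (2 *: 'X + 0%:R%:P)).[t%:R] <= (2 ^+ N *: (Q \Po ('X + b%:R%:P))).[t%:R]).
  have [b' le] := hilb_squares_upper F p; exists b'.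
  have [t0 h] := hP; have [t1 h'] := hQ; exists (maxn t0 t1) => t; rewrite geq_max => /andP[tt0 tt1].
  rewrite !(horner_comp, hornerE) -natrM -natrD h ?h'; [|lia|lia].
  by rewrite -natrX -natrM ler_nat.
have N0 : 2 ^+ N != 0 :> rat by rewrite expf_neq0 ?pnatr_eq0.
have size_sh (c : rat) : size (2 ^+ N *: (Q \Po ('X + c%:P))) = size Q.
  by rewrite size_scale // size_comp_poly2 // size_XaddC.
have sQ : size Q = d.+1.
  apply/eqP; rewrite eqn_leq; apply/andP; split.
    rewrite -(size_dil b) -(size_scale Q N0); apply: growth_size lo.
    by case: Q0 => t0 h; exists t0 => t /h; rewrite hornerZ => ?; rewrite mulr_ge0 ?exprn_ge0.
  rewrite -(size_dil 0%N) -(size_sh b'%:R); apply: growth_size up.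
  by case: P0 => t0 h; exists t0 => t tt; rewrite horner_comp !hornerE -natrM h //; lia.
(* The bounded shifts do not affect leading terms, so [2 ^+ N *: Q] has the leading term of
   [P(2 t)], in which the dilation contributes [2 ^+ d]. *)
have lQ : 2 ^+ N * lead_coef Q = lead_coef P * 2 ^+ d.
  apply/le_anti/andP; split.
    rewrite -(coef_dil b) lead_coefE sQ -coefZ; apply: growth_coef lo.
      by rewrite size_scale // sQ.
    by rewrite size_dil.
  have -> : 2 ^+ N * lead_coef Q = (2 ^+ N *: (Q \Po ('X + b'%:R%:P)))`_d.
    have := lead_coef_comp Q (q := 'X + b'%:R%:P); rewrite size_XaddC lead_coefXaddC sQ => /(_ isT).
    by rewrite expr1n mulr1 coefZ {1}lead_coefE size_comp_poly2 ?size_XaddC // sQ => ->.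
  rewrite -(coef_dil 0%N).
  by apply: growth_coef up; rewrite ?size_dil ?size_sh ?sQ.
have pO : is_hilbert_poly (OO F m) P.
  by case: hP => t0 h; exists t0 => t /h ->; rewrite hilbert_fun_OO.
have pS : is_hilbert_poly (coordwise_power 2 (OO F m)) Q.
  by case: hQ => t0 h; exists t0 => t /h ->; rewrite hilbert_fun_square_OO.
rewrite (proj_degreeE pO) (proj_degreeE pS) sP sQ /=; split.
  by rewrite -mulrA [lead_coef Q * _]mulrC lQ; ring.
by rewrite lead_coefE sP.
Qed.

Theorem proposition2p4 (R : realType) (m : nat) (hm : (1 <= m)%N) :
  coordwise_power 2 (OO (complex R) m) = coordwise_power 2 (SO (complex R) m) /\
  proj_degree (coordwise_power 2 (OO (complex R) m)) =
    2 ^+ ((m - 1) ^ 2)%N *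
      (proj_degree (OO (complex R) m) / 2 ^+ 'C(m.+1, 2)) /\
  2 ^+ ((m - 1) ^ 2)%N *
      (proj_degree (OO (complex R) m) / 2 ^+ 'C(m.+1, 2))
    <= 2 ^+ ((m - 1) ^ 2)%N :> rat.
Proof.
case: m hm => // p _; have two0 k : 2 ^+ k != 0 :> rat by rewrite expf_neq0 ?pnatr_eq0.
have [eq le] := degree_square_OO (complex R) p; split; first exact: coordwise_square_OO.
rewrite subn1 /=; split.
  apply: (mulIf (two0 (2 * p + 1)%N)); rewrite eq; apply: (mulIf (two0 'C(p.+2, 2))).
  (* The dimension of O(m) and the number of equations add up to [m ^ 2]; removing the [2 * p + 1]
     independent signs leaves the exponent [(m - 1) ^ 2]. *)
  have e : ('C(p.+1, 2) + 'C(p.+2, 2) = p ^ 2 + (2 * p + 1))%N.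
    by rewrite bin2_sum_square; lia.
  move: (proj_degree _) => D; rewrite [LHS]mulrAC -exprD e exprD.
  rewrite -!mulrA; congr (_ * _).
  by rewrite [X in D * (_ * X)]mulrC mulKf // mulrC.
rewrite ler_piMr ?exprn_ge0 // ler_pdivrMr ?exprn_gt0 // mul1r; exact: le.
Qed.
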